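(* Assume $(X,r)$ is a finite left non-degenerate idempotent set-theoretic solution of the Yang--Baxter equation. If $M=M(X,r)$ and $K$ is a field, then the following conditions are equivalent: \begin{enumerate} \item $|\Lambda|=1$. \item the monoid $M$ is cancellative. \item there exists an operation $\cdot$ on $X$ so that $(X,\cdot)$ is a group and there exists a homomorphism $\varphi$ on this group so that $\lambda_x(y)=x\cdot\varphi(y)$ for all $x,y\in X$. \item the algebra $K[M]$ is right Noetherian. \item the algebra $K[M]$ is not central (that is, its center is strictly bigger than $K$). \end{enumerate} Furthermore, if $\mathrm{char}\,K$ does not divide $|X|$, these conditions are equivalent with \begin{enumerate} \item[(6)] the algebra $K[M]$ is semiprime. \end{enumerate} For arbitrary fields $K$, (6) implies (1). Moreover, if any of these conditions is satisfied then $K[M]$ is a subalgebra of $K[G_u]\cong K[T(G_u)][t^{\pm1};\sigma]$ (where $\Lambda=\{u\}$), the skew Laurent polynomial algebra in the variable $t$ over the group algebra $K[T(G_u)]$ of the finite group $T(G_u)$.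
   Context: A set-theoretic solution of the Yang--Baxter equation is a pair $(X,r)$ with $X$ a non-empty set and $r\colon X\times X\to X\times X$ a map satisfying $(r\times\mathrm{id})(\mathrm{id}\times r)(r\times\mathrm{id})=(\mathrm{id}\times r)(r\times\mathrm{id})(\mathrm{id}\times r)$. Write $r(x,y)=(\lambda_x(y),\rho_y(x))$. It is finite if $X$ is finite, left non-degenerate if every $\lambda_x\colon X\to X$ is bijective, and idempotent if $r^2=r$. The diagonal map is $q\colon X\to X$, $q(x)=\lambda_x^{-1}(x)$, and $\Lambda=q(X)$. The structure monoid is $M=M(X,r)=\langle X\mid x\circ y=\lambda_x(y)\circ\rho_y(x),\ x,y\in X\rangle$, the structure semigroup is $S=S(X,r)=M\setminus\{1\}$, and $K[M]$ is the monoid algebra (structure algebra). The groups $G_u$: for $(X,r)$ left non-degenerate and idempotent, let $A=\langle X\mid x+y=y+y,\ x,y\in X\rangle$ (additive monoid); every non-zero element is uniquely $nx$ with $n\ge1$, $x\in X$, and $|nx|=n$. Each $\lambda_x$ extends to an automorphism of $A$, giving a monoid homomorphism $\lambda\colon M\to\mathrm{Aut}(A,+)$; there is a bijection $\pi\colon M\to A$ with $\pi(x)=x$ and $\pi(m\circ m')=\pi(m)+\lambda_m(\pi(m'))$. Writing $\lambda_a=\lambda_{\pi^{-1}(a)}$ and identifying $m$ with $(\pi(m),\lambda_m)$, $M=\{(a,\lambda_a):a\in A\}$ with $(a,\lambda_a)\circ(b,\lambda_b)=(a+\lambda_a(b),\lambda_a\lambda_b)$. For $u\in\Lambda$, $S_u=\{(a,\lambda_a)\in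 S:\lambda_a^{-1}(a)=|a|u\}$ is a cancellative subsemigroup of $S$ (and $S$ is the disjoint union of the $S_u$, so $S=S_u$ if $\Lambda=\{u\}$); it has a group of quotients $G_u$, whose elements of finite order form a finite subgroup $T(G_u)$ with $G_u/T(G_u)\cong\mathbb{Z}$. The automorphism $\sigma$ of $K[T(G_u)]$ is induced by conjugation by an element of $G_u$ whose coset generates $G_u/T(G_u)$. *)

(* Defs.v *)
From HB Require Import structures.
From mathcomp Require Import all_boot all_algebra generic_quotient.
From mathcomp Require Import finmap.
From mathcomp Require Import boolp.
From mathcomp Require Import monalg.

Set Implicit Arguments.
Unset Strict Implicit.
Unset Printing Implicit Defensive.

Import GRing.Theory.
Local Open Scope fset_scope.
Local Open Scope ring_scope.

(* ---------------------------------------------------------------------- *)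
(* Monoid presentations: words modulo the congruence generated by rel.     *)
Section PresentedMonoid.
Variables (X : choiceType) (rel : seq X -> seq X -> Prop).

Inductive mcong : seq X -> seq X -> Prop :=
| mcong_gen u v : rel u v -> mcong u v
| mcong_refl u : mcong u u
| mcong_sym u v : mcong u v -> mcong v u
| mcong_trans v u w : mcong u v -> mcong v w -> mcong u w
| mcong_cat u u' v v' : mcong u u' -> mcong v v' -> mcong (u ++ v) (u' ++ v').

Definition mcongb (u v : seq X) : bool := `[< mcong u v >].

Lemma mcongb_refl : reflexive mcongb.
Proof. by move=> u; apply/asboolP; exact: mcong_refl. Qed.

Lemma mcongb_sym : symmetric mcongb.
Proof. by move=> u v; apply/asboolP/asboolP; exact: mcong_sym. Qed.

Lemma mcongb_trans : transitive mcongb.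
Proof.
by move=> v u w /asboolP uv /asboolP vw; apply/asboolP; exact: mcong_trans vw.
Qed.

Canonical mcong_equiv := EquivRel mcongb mcongb_refl mcongb_sym mcongb_trans.

Definition presented := {eq_quot mcong_equiv}%qT.
HB.instance Definition _ := Choice.on presented.
HB.instance Definition _ := EqQuotient.on presented.

Definition pword (u : seq X) : presented := (\pi_presented u)%qT.
Definition prepr (a : presented) : seq X := repr a.

Lemma preprK a : pword (prepr a) = a.
Proof. exact: reprK. Qed.

Lemma pword_eq u v : (pword u = pword v) <-> mcong u v.
Proof.
split=> [/eqP | uv]; first by rewrite /pword eqmodE /= => /asboolP.
by apply/eqP; rewrite /pword eqmodE /=; apply/asboolP.
Qed.

Lemma mcong_prepr u : mcong (prepr (pword u)) u.
Proof. by apply/pword_eq; rewrite preprK. Qed.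

Definition pone : presented := pword [::].
Definition pmul (a b : presented) : presented := pword (prepr a ++ prepr b).

Lemma pword_cat u v : pmul (pword u) (pword v) = pword (u ++ v).
Proof. by apply/pword_eq/mcong_cat; apply: mcong_prepr. Qed.

Lemma pmulA : associative pmul.
Proof.
move=> a b c; rewrite -(preprK a) -(preprK b) -(preprK c).
by rewrite !pword_cat catA.
Qed.

Lemma pmul1 : left_id pone pmul.
Proof. by move=> a; rewrite -(preprK a) pword_cat. Qed.

Lemma pmulr1 : right_id pone pmul.
Proof. by move=> a; rewrite -(preprK a) pword_cat cats0. Qed.

HB.instance Definition _ := isMonoid.Build presented pmulA pmul1 pmulr1.

Lemma pword_mul u v : (pword u * pword v)%g = pword (u ++ v).
Proof. exact: pword_cat. Qed.

End PresentedMonoid.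

(* ---------------------------------------------------------------------- *)
(* Skew monoid algebras R * G over K: finite sums of a_x x (a_x in R, x in *)
(* G) with (a x)(b y) = (a act_x(b)) (x y).  monalg's own ring structure on *)
(* {malg R[G]} needs 1 to be the only invertible element of G, which        *)
(* excludes groups.                                                        *)
Record alg_action (K : comNzRingType) (R : algType K) (G : monoidType) :=
  AlgAction {
    act :> G -> R -> R;
    act1g : forall a, act 1%g a = a;
    actMg : forall x y a, act (x * y)%g a = act x (act y a);
    act_linear : forall x, linear (act x);
    act_one : forall x, act x 1 = 1;
    act_mul : forall x, {morph act x : a b / a * b}
  }.

Section SkewMonoidAlgebra.
Context (K : comNzRingType) (R : algType K) (G : monoidType).
Variable alpha : alg_action R G.

Lemma act_D x : {morph alpha x : a b / a + b}.
Proof. by move=> a b; have := act_linear alpha x 1 a b; rewrite !scale1r. Qed.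

Lemma act_0 x : alpha x 0 = 0.
Proof. by apply: (addrI (alpha x 0)); rewrite -act_D !addr0. Qed.

Lemma act_Z x k a : alpha x (k *: a) = k *: alpha x a.
Proof. by have := act_linear alpha x k a 0; rewrite !addr0 act_0 addr0. Qed.

Definition skew_alg (_ : alg_action R G) : Type := {malg R[G]}.
Local Notation RG := (skew_alg alpha).
HB.instance Definition _ := Choice.copy RG {malg R[G]}.
HB.instance Definition _ := GRing.Zmodule.copy RG {malg R[G]}.

Implicit Types f g h : {malg R[G]}.

Definition skew_one : {malg R[G]} := mkmalgU (1%g : G) 1.

Definition skew_mul f g : {malg R[G]} :=
  \sum_(x <- msupp f) \sum_(y <- msupp g)
     mkmalgU (x * y)%g (mcoeff x f * alpha x (mcoeff y g)).

Lemma skew_mulw (d1 d2 : {fset G}) f g :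
    msupp f `<=` d1 -> msupp g `<=` d2 ->
  skew_mul f g = \sum_(x <- d1) \sum_(y <- d2)
     mkmalgU (x * y)%g (mcoeff x f * alpha x (mcoeff y g)).
Proof.
move=> le1 le2; rewrite /skew_mul (big_fset_incl _ le1) /=.
  apply/eq_bigr=> x _; apply/big_fset_incl => // y _ /mcoeff_outdom ->.
  by rewrite act_0 mulr0 monalgU0.
move=> x _ /mcoeff_outdom fx.
by rewrite big1 // => y _; rewrite fx mul0r monalgU0.
Qed.

Lemma skew_mul0g : left_zero 0 skew_mul.
Proof. by move=> g; rewrite /skew_mul msupp0 big_seq_fset0. Qed.

Lemma skew_mulg0 : right_zero 0 skew_mul.
Proof. by move=> g; rewrite /skew_mul big1 // => x _; rewrite msupp0 big_seq_fset0. Qed.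

Lemma skew_mulUg a x g : skew_mul (mkmalgU x a) g =
  \sum_(y <- msupp g) mkmalgU (x * y)%g (a * alpha x (mcoeff y g)).
Proof.
rewrite (skew_mulw msuppU_le (fsubset_refl _)) big_seq_fset1.
by apply/eq_bigr => y _; rewrite mcoeffUU.
Qed.

Lemma skew_mulgU a x g : skew_mul g (mkmalgU x a) =
  \sum_(y <- msupp g) mkmalgU (y * x)%g (mcoeff y g * alpha y a).
Proof.
rewrite (skew_mulw (fsubset_refl _) msuppU_le).
by apply/eq_bigr => y _; rewrite big_seq_fset1 mcoeffUU.
Qed.

Lemma skew_mulUU a b x y :
  skew_mul (mkmalgU x a) (mkmalgU y b) = mkmalgU (x * y)%g (a * alpha x b).
Proof. by rewrite (skew_mulw msuppU_le msuppU_le) !big_seq_fset1 !mcoeffUU. Qed.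

Lemma skew_mulgDl : left_distributive skew_mul +%R.
Proof.
move=> g1 g2 g.
rewrite [in RHS](skew_mulw (fsubsetUl _ (msupp g2)) (fsubset_refl _)).
rewrite [in RHS](skew_mulw (fsubsetUr (msupp g1) _) (fsubset_refl _)).
rewrite (skew_mulw (msuppD_le _ _) (fsubset_refl _)).
rewrite -big_split /=; apply/eq_bigr=> k1 _.
rewrite -big_split /=; apply/eq_bigr=> k2 _.
by rewrite mcoeffD mulrDl monalgUD.
Qed.

Lemma skew_mulgDr : right_distributive skew_mul +%R.
Proof.
move=> g g1 g2.
rewrite [in RHS](skew_mulw (fsubset_refl _) (fsubsetUl _ (msupp g2))).
rewrite [in RHS](skew_mulw (fsubset_refl _) (fsubsetUr (msupp g1) _)).
rewrite (skew_mulw (fsubset_refl _) (msuppD_le _ _)).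
rewrite -big_split /=; apply/eq_bigr=> k1 _.
rewrite -big_split /=; apply/eq_bigr=> k2 _.
by rewrite mcoeffD act_D mulrDr monalgUD.
Qed.

Lemma skew_mul1g : left_id skew_one skew_mul.
Proof.
move=> g; rewrite skew_mulUg [RHS]monalgE.
by apply/eq_bigr=> x _; rewrite mul1r act1g mul1g.
Qed.

Lemma skew_mulg1 : right_id skew_one skew_mul.
Proof.
move=> g; rewrite skew_mulgU [RHS]monalgE.
by apply/eq_bigr=> x _; rewrite act_one mulr1 mulg1.
Qed.

Lemma skew_mulEl f g :
  skew_mul f g = \sum_(x <- msupp f) skew_mul (mkmalgU x (mcoeff x f)) g.
Proof. by apply/eq_bigr=> x _; rewrite skew_mulUg. Qed.

Lemma skew_mulEr f g :
  skew_mul f g = \sum_(y <- msupp g) skew_mul f (mkmalgU y (mcoeff y g)).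
Proof.
rewrite /skew_mul exchange_big /=; apply/eq_bigr=> y _.
by rewrite -/(skew_mul _ _) skew_mulgU.
Qed.

Lemma skew_mulA : associative skew_mul.
Proof.
move=> g1 g2 g3.
rewrite [RHS](big_morph (skew_mul^~ _)
  (fun _ _ => skew_mulgDl _ _ _) (skew_mul0g _)).
rewrite skew_mulEl; apply/eq_bigr=> k1 _.
rewrite [LHS](big_morph (skew_mul _)
  (fun _ _ => skew_mulgDr _ _ _) (skew_mulg0 _)).
rewrite [RHS](big_morph (skew_mul^~ _)
  (fun _ _ => skew_mulgDl _ _ _) (skew_mul0g _)).
apply/eq_bigr=> k2 _.
rewrite [LHS](big_morph (skew_mul _)
  (fun _ _ => skew_mulgDr _ _ _) (skew_mulg0 _)).
rewrite skew_mulEr; apply/eq_bigr=> k3 _.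
by rewrite !skew_mulUU act_mul actMg mulrA mulgA.
Qed.

Lemma skew_one_neq0 : skew_one != 0.
Proof. by rewrite monalgU_eq0 oner_eq0. Qed.

HB.instance Definition _ := GRing.Zmodule_isNzRing.Build RG
  skew_mulA skew_mul1g skew_mulg1 skew_mulgDl skew_mulgDr skew_one_neq0.

Definition skew_scale (k : K) (f : {malg R[G]}) : {malg R[G]} := k%:A *: f.

Lemma skew_scaleE k f x : mcoeff x (skew_scale k f) = k *: mcoeff x f.
Proof. by rewrite mcoeffZ -scalerAl mul1r. Qed.

Lemma skew_scaleA k l (f : RG) :
  skew_scale k (skew_scale l f) = skew_scale (k * l) f.
Proof. by apply/malgP=> x; rewrite !skew_scaleE scalerA. Qed.

Lemma skew_scale1 : left_id (1 : K) skew_scale.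
Proof. by move=> f; apply/malgP=> x; rewrite skew_scaleE scale1r. Qed.

Lemma skew_scaleDr : right_distributive skew_scale +%R.
Proof.
by move=> k f g; apply/malgP=> x; rewrite !(skew_scaleE, mcoeffD) scalerDr.
Qed.

Lemma skew_scaleDl (f : {malg R[G]}) :
  {morph skew_scale^~ f : k l / k + l}.
Proof.
by move=> k l; apply/malgP=> x; rewrite !(skew_scaleE, mcoeffD) scalerDl.
Qed.

HB.instance Definition _ := GRing.Zmodule_isLmodule.Build K RG
  skew_scaleA skew_scale1 skew_scaleDr skew_scaleDl.

Lemma msupp_skew_scale k f : msupp (skew_scale k f) `<=` msupp f.
Proof. exact: msuppZ_le. Qed.

Lemma skew_scaleU k x a : skew_scale k (mkmalgU x a) = mkmalgU x (k *: a).
Proof.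
by apply/malgP=> y; rewrite skew_scaleE !mcoeffU scalerMnr.
Qed.

Lemma skew_scale_sum k (I : Type) (s : seq I) (F : I -> {malg R[G]}) :
  skew_scale k (\sum_(i <- s) F i) = \sum_(i <- s) skew_scale k (F i).
Proof.
apply: (big_morph (skew_scale k)); first exact: skew_scaleDr.
by apply/malgP=> x; rewrite skew_scaleE !mcoeff0 scaler0.
Qed.

Lemma skew_scaleAl k (f g : RG) : k *: (f * g) = k *: f * g.
Proof.
change (skew_scale k (skew_mul f g) = skew_mul (skew_scale k f) g).
rewrite (skew_mulw (msupp_skew_scale k f) (fsubset_refl (msupp g))).
rewrite skew_scale_sum; apply/eq_bigr=> x _.
rewrite skew_scale_sum; apply/eq_bigr=> y _.
by rewrite skew_scaleU skew_scaleE scalerAl.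
Qed.

HB.instance Definition _ := GRing.Lmodule_isLalgebra.Build K RG
  skew_scaleAl.

Lemma skew_scaleAr k (f g : RG) : k *: (f * g) = f * (k *: g).
Proof.
change (skew_scale k (skew_mul f g) = skew_mul f (skew_scale k g)).
rewrite (skew_mulw (fsubset_refl (msupp f)) (msupp_skew_scale k g)).
rewrite skew_scale_sum; apply/eq_bigr=> x _.
rewrite skew_scale_sum; apply/eq_bigr=> y _.
by rewrite skew_scaleU skew_scaleE act_Z scalerAr.
Qed.

HB.instance Definition _ := GRing.Lalgebra_isAlgebra.Build K RG
  skew_scaleAr.

End SkewMonoidAlgebra.

(* The monoid algebra K[G]: coefficients in K, trivial action.             *)
Section MonoidAlgebra.
Context (K : comNzRingType) (G : monoidType).

Fact trivial_act_linear (_ : G) : linear (@id K^o).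
Proof. by []. Qed.

Definition trivial_action : alg_action K^o G :=
  @AlgAction K K^o G (fun _ => id) (fun _ => erefl) (fun _ _ _ => erefl)
    trivial_act_linear (fun _ => erefl) (fun _ _ _ => erefl).

Definition monoid_alg : algType K := skew_alg trivial_action.

Definition mbase (x : G) : monoid_alg := mkmalgU x (1 : K^o).

Lemma mbase1 : mbase 1%g = 1.
Proof. by []. Qed.

Lemma mbaseM x y : mbase (x * y)%g = mbase x * mbase y.
Proof. by rewrite [RHS]skew_mulUU mulr1. Qed.

End MonoidAlgebra.
Arguments monoid_alg K G : clear implicits.
Arguments mbase K {G} x.

(* ---------------------------------------------------------------------- *)
(* Skew Laurent polynomials R[t^{+-1}; sigma], with t a = sigma(a) t.      *)
Record alg_aut (K : comNzRingType) (R : algType K) := AlgAut {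
  aut_fun :> {lrmorphism R -> R};
  aut_inv : R -> R;
  aut_funK : cancel aut_fun aut_inv;
  aut_invK : cancel aut_inv aut_fun
}.

Section SkewLaurent.
Context (K : comNzRingType) (R : algType K) (sigma : alg_aut R).

Definition aut_iter (n : int) (a : R) : R :=
  match n with
  | Posz m => iter m sigma a
  | Negz m => iter m.+1 (aut_inv sigma) a
  end.

Lemma aut_iterS n a : aut_iter (1 + n) a = sigma (aut_iter n a).
Proof.
case: n => [n | [|n]]; first by [].
  by rewrite /= aut_invK.
have ->: 1 + Negz n.+1 = Negz n.
  by rewrite !NegzE -[n.+2]add1n PoszD opprD addrA subrr add0r.
by rewrite /= aut_invK.
Qed.

Lemma aut_iterP n a : aut_iter (- 1 + n) a = aut_inv sigma (aut_iter n a).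
Proof. by rewrite -{2}[n](addrNK 1) [_ - 1 + 1]addrC aut_iterS aut_funK addrC. Qed.

Lemma aut_iterD (m n : Algebra.to_multiplicative int) a :
  aut_iter (m * n)%g a = aut_iter m (aut_iter n a).
Proof.
change (aut_iter ((m : int) + n) a = aut_iter m (aut_iter n a)).
elim/int_rec: (m : int) => [|k IH|k IH]; first by rewrite add0r.
  by rewrite intS -addrA !aut_iterS IH.
by rewrite intS opprD -addrA !aut_iterP IH.
Qed.

Lemma aut_inv_linear : linear (aut_inv sigma).
Proof.
move=> k a b; apply: (can_inj (aut_funK sigma)).
by rewrite [LHS]aut_invK linearP /= !aut_invK.
Qed.

Lemma aut_inv_mul : {morph aut_inv sigma : a b / a * b}.
Proof.
move=> a b; apply: (can_inj (aut_funK sigma)).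
by rewrite [LHS]aut_invK rmorphM /= !aut_invK.
Qed.

Lemma aut_inv1 : aut_inv sigma 1 = 1.
Proof. by rewrite -[in LHS](rmorph1 sigma) aut_funK. Qed.

Lemma aut_iter_linear (n : Algebra.to_multiplicative int) : linear (aut_iter n).
Proof.
move=> k a b; elim/int_rec: (n : int) => [|m IH|m IH] //.
  by rewrite intS !aut_iterS IH linearP.
by rewrite intS opprD !aut_iterP IH aut_inv_linear.
Qed.

Lemma aut_iter1 (n : Algebra.to_multiplicative int) : aut_iter n 1 = 1.
Proof.
elim/int_rec: (n : int) => [|m IH|m IH] //.
  by rewrite intS aut_iterS IH rmorph1.
by rewrite intS opprD aut_iterP IH aut_inv1.
Qed.

Lemma aut_iterM (n : Algebra.to_multiplicative int) :
  {morph aut_iter n : a b / a * b}.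
Proof.
move=> a b; elim/int_rec: (n : int) => [|m IH|m IH] //.
  by rewrite intS !aut_iterS IH rmorphM.
by rewrite intS opprD !aut_iterP IH aut_inv_mul.
Qed.

Definition aut_action : alg_action R (Algebra.to_multiplicative int) :=
  @AlgAction K R (Algebra.to_multiplicative int) aut_iter (fun _ => erefl) aut_iterD
    aut_iter_linear aut_iter1 aut_iterM.

Definition skew_laurent : algType K := skew_alg aut_action.

Lemma skew_laurentE (a b : R) (m n : Algebra.to_multiplicative int) :
  (mkmalgU m a : skew_laurent) * (mkmalgU n b : skew_laurent) =
  mkmalgU (m * n)%g (a * aut_iter m b).
Proof. exact: skew_mulUU. Qed.

End SkewLaurent.

(* ---------------------------------------------------------------------- *)
Section RingNotions.
Variable R : nzRingType.

Definition right_ideal (I : R -> Prop) : Prop :=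
  [/\ I 0, forall a b, I a -> I b -> I (a + b) & forall a b, I a -> I (a * b)].

Definition two_sided_ideal (I : R -> Prop) : Prop :=
  right_ideal I /\ forall a b, I b -> I (a * b).

Definition right_noetherian : Prop :=
  forall I : nat -> R -> Prop,
    (forall n, right_ideal (I n)) ->
    (forall n a, I n a -> I n.+1 a) ->
  exists N, forall n a, (N <= n)%N -> I n a -> I N a.

Definition nilpotent_ideal (I : R -> Prop) : Prop :=
  exists n, forall s : 'I_n -> R, (forall k, I (s k)) -> \prod_(k < n) s k = 0.

Definition semiprime : Prop :=
  forall I, two_sided_ideal I -> nilpotent_ideal I -> forall a, I a -> a = 0.

Definition in_center (a : R) : Prop := forall b, a * b = b * a.

End RingNotions.

Definition central_alg (K : comNzRingType) (R : algType K) : Prop :=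
  forall a : R, in_center a -> exists k : K, a = k%:A.

(* ---------------------------------------------------------------------- *)
Definition cancellative (G : monoidType) : Prop :=
  (forall a b c : G, a * b = a * c -> b = c)%g /\
  (forall a b c : G, b * a = c * a -> b = c)%g.

Definition is_group (X : Type) (op : X -> X -> X) : Prop :=
  associative op /\
  exists (e : X) (inv : X -> X),
    [/\ left_id e op, right_id e op, left_inverse e inv op
      & right_inverse e inv op].

(* Only the values of i on the subsemigroup S matter.                      *)
Definition group_of_quotients (M : monoidType) (S : M -> Prop)
    (G : groupType) (i : M -> G) : Prop :=
  [/\ forall s t, S s -> S t -> i (s * t)%g = (i s * i t)%g,
      forall s t, S s -> S t -> i s = i t -> s = t
    & forall g, exists s t, [/\ S s, S t & g = (i s * (i t)^-1)%g]].

(* j identifies T with the set of elements of finite order of G.           *)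
Definition torsion_subgroup (G T : groupType) (j : T -> G) : Prop :=
  [/\ forall x y, j (x * y)%g = (j x * j y)%g,
      injective j
    & forall g, (exists2 n, (0 < n)%N & (g ^+ n)%g = 1%g) <->
                (exists x, g = j x)].

(* The coset of g generates G / j(T).                                      *)
Definition coset_generates (G T : groupType) (j : T -> G) (g : G) : Prop :=
  forall h, exists (n : nat) (x : T),
    h = (g ^+ n * j x)%g \/ h = (g ^- n * j x)%g.

(* sigma is induced by x |-> g x g^-1 on T, seen in G through j.           *)
Definition induced_by_conj (K : comNzRingType) (G T : groupType) (j : T -> G)
    (g : G) (sigma : alg_aut (monoid_alg K T)) : Prop :=
  forall x, exists2 y, j y = (g * j x * g^-1)%g
                     & sigma (mbase K x) = mbase K y.

(* ---------------------------------------------------------------------- *)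
Section Solutions.
Variables (X : finType) (r : X * X -> X * X).

Definition lam (x y : X) : X := (r (x, y)).1.
Definition rho (y x : X) : X := (r (x, y)).2.

Definition r12 (t : X * X * X) : X * X * X := (r t.1, t.2).
Definition r23 (t : X * X * X) : X * X * X :=
  (t.1.1, (r (t.1.2, t.2)).1, (r (t.1.2, t.2)).2).

Definition yang_baxter : Prop :=
  forall t, r12 (r23 (r12 t)) = r23 (r12 (r23 t)).

Definition left_nondegenerate : Prop := forall x, bijective (lam x).

Definition idempotent_map : Prop := forall p, r (r p) = r p.

Definition diag (x : X) : X := finv (lam x) x.

Definition Lambda : {set X} := [set diag x | x : X].

Definition structure_rel (u v : seq X) : Prop :=
  exists x y, u = [:: x; y] /\ v = [:: lam x y; rho y x].

Definition structure_monoid : monoidType := presented structure_rel.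

(* The additive monoid A, written multiplicatively: nx is x ^+ n.          *)
Definition additive_rel (u v : seq X) : Prop :=
  exists x y, u = [:: x; y] /\ v = [:: y; y].

Definition additive_monoid : monoidType := presented additive_rel.

Local Notation M := structure_monoid.
Local Notation A := additive_monoid.

Definition mgen (x : X) : M := pword structure_rel [:: x].
Definition agen (x : X) : A := pword additive_rel [:: x].

(* The endomorphism of A that extends f : X -> X; an automorphism when f   *)
(* is a permutation.                                                       *)
Definition aext (f : X -> X) (a : A) : A :=
  pword additive_rel [seq f x | x <- prepr a].

(* lambda_m, restricted to the generators X of A.                          *)
Definition lamw (w : seq X) : X -> X := foldr (fun x f => lam x \o f) id w.
Definition lamM (m : M) : X -> X := lamw (prepr m).

Fixpoint piw (w : seq X) : A :=
  if w is x :: w' then (agen x * aext (lam x) (piw w'))%g else 1%g.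
Definition piM (m : M) : A := piw (prepr m).

(* |nx| = n: the relations of A preserve the length of words.              *)
Definition adeg (a : A) : nat := size (prepr a).

(* m = (a, lambda_a) is in S_u iff m is not 1 and lambda_a^-1 (a) = |a| u. *)
Definition Ssub (u : X) (m : M) : Prop :=
  m <> 1%g /\ aext (finv (lamM m)) (piM m) = (agen u ^+ adeg (piM m))%g.

Lemma additive_mcong_map (f : X -> X) u v :
  mcong additive_rel u v -> mcong additive_rel (map f u) (map f v).
Proof.
elim=> {u v} [u v [x [y [-> ->]]] | u | u v _ | v u w _ uv _ vw
             | u u' v v' _ uu' _ vv'] /=.
- by apply: mcong_gen; exists (f x), (f y).
- exact: mcong_refl.
- exact: mcong_sym.
- exact: mcong_trans vw.
- by rewrite !map_cat; apply: mcong_cat.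
Qed.

Lemma aextE f w : aext f (pword _ w) = pword _ (map f w).
Proof. by apply/pword_eq/additive_mcong_map/mcong_prepr. Qed.

Lemma aext_gen f x : aext f (agen x) = agen (f x).
Proof. exact: aextE. Qed.

Lemma aextM f : {morph aext f : a b / (a * b)%g}.
Proof.
move=> a b; rewrite -(preprK a) -(preprK b).
by rewrite pword_mul !aextE map_cat pword_mul.
Qed.

Lemma aext1 f : aext f 1%g = 1%g.
Proof. exact: (aextE f [::]). Qed.

Lemma aext_comp f g a : aext f (aext g a) = aext (f \o g) a.
Proof. by rewrite -(preprK a) !aextE map_comp. Qed.

Lemma eq_aext f g : f =1 g -> aext f =1 aext g.
Proof. by move=> fg a; rewrite /aext (eq_map fg). Qed.

Lemma aext_id a : aext id a = a.
Proof. by rewrite /aext map_id preprK. Qed.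

Lemma additive_mcong_size u v : mcong additive_rel u v -> size u = size v.
Proof.
elim=> {u v} [u v [x [y [-> ->]]] | // | // | v u w _ -> // |
             u u' v v' _ uu' _ vv'] //.
by rewrite !size_cat uu' vv'.
Qed.

Lemma adegE w : adeg (pword _ w) = size w.
Proof. exact/additive_mcong_size/mcong_prepr. Qed.

Lemma agen_absorb x y : (agen x * agen y = agen y * agen y :> A)%g.
Proof.
rewrite !pword_mul.
by apply/pword_eq/mcong_gen; exists x, y.
Qed.

Lemma lamw_cat u v : lamw (u ++ v) =1 lamw u \o lamw v.
Proof. by elim: u => //= x u IH y /=; rewrite IH. Qed.

Lemma piw_cat u v : piw (u ++ v) = (piw u * aext (lamw u) (piw v))%g.
Proof.
elim: u => [|x u IH] /=; first by rewrite aext_id mul1g.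
by rewrite IH aextM aext_comp mulgA.
Qed.

Section WellDefined.
Hypotheses (ybe : yang_baxter) (lnd : left_nondegenerate)
  (idem : idempotent_map).

Lemma lam_comp x y z : lam x (lam y z) = lam (lam x y) (lam (rho y x) z).
Proof.
by have /(congr1 (fun t => t.1.1)) := ybe (x, y, z).
Qed.

Lemma lam_rho x y : lam (lam x y) (rho y x) = lam x y.
Proof.
by rewrite /lam /rho -surjective_pairing idem.
Qed.

Lemma lamw_cong u v : mcong structure_rel u v -> lamw u =1 lamw v.
Proof.
elim=> {u v} [u v [x [y [-> ->]]] z | // | u v _ uv z | v u w _ uv _ vw z
             | u u' v v' _ uu' _ vv' z] //=.
- exact: lam_comp.
- by rewrite uv vw.
- by rewrite !lamw_cat /= uu' vv'.
Qed.

Lemma piw_cong u v : mcong structure_rel u v -> piw u = piw v.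
Proof.
elim=> {u v} [u v [x [y [-> ->]]] | // | // | v u w _ -> _ -> //
             | u u' v v' uu IHu _ IHv] //=.
- rewrite !aext1 !mulg1 !aext_gen lam_rho; exact: agen_absorb.
- by rewrite !piw_cat IHu IHv (eq_aext (lamw_cong uu)).
Qed.

Lemma lamM_mgen x : lamM (mgen x) =1 lam x.
Proof. by move=> y; rewrite /lamM (lamw_cong (mcong_prepr _ _)). Qed.

Lemma lamM_mul m n : lamM (m * n)%g =1 lamM m \o lamM n.
Proof.
by move=> y; rewrite /lamM (lamw_cong (mcong_prepr _ _)) lamw_cat.
Qed.

Lemma lamM_bij m : bijective (lamM m).
Proof.
rewrite /lamM; elim: (prepr m) => [|x w IH] /=; first by exists id.
exact: bij_comp (lnd x) IH.
Qed.

Lemma piM_mgen x : piM (mgen x) = agen x.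
Proof. by rewrite /piM (piw_cong (mcong_prepr _ _)) /= aext1 mulg1. Qed.

Lemma piM_mul m n : piM (m * n)%g = (piM m * aext (lamM m) (piM n))%g.
Proof. by rewrite /piM (piw_cong (mcong_prepr _ _)) piw_cat. Qed.

Lemma aext_lamMK m : cancel (aext (lamM m)) (aext (finv (lamM m))).
Proof.
move=> a; rewrite aext_comp -[RHS]aext_id; apply: eq_aext => x /=.
by rewrite finv_f //; exact: bij_inj (lamM_bij m).
Qed.

End WellDefined.

End Solutions.

Arguments Ssub {X} r u m.

(* Main.v *)
(* Write q = diag.  Idempotence forces rho_y(x) = q(lam_x(y)), so x o y only
   depends on lam_x(y), and M \ {1} is in bijection with pairs (n, x) under
     (n, x) o (m, y) = (n + m, lam_(n,x)(y)).
   Since q(q(lam_x(y))) = q(y), the diagonal map is constant as soon as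
   x |-> lam_x^-1(z) is injective for every z; this holds when M is
   cancellative, and also when x |-> lam_x is injective.
   If q is not constant, there are therefore, in every degree n, points
   x <> x' with lam_(n,x) = lam_(n,x').  The elements (n, x) - (n, x') kill
   M \ {1} on the left: they span a square-zero ideal and infinite ascending
   chains of right ideals.  The centre is K because a product (n, x) o (m, y)
   lies in the class S_u of its right factor.
   If q is constantly u, then x . lam_u(y) = lam_x(y) defines a group with unit
   u and lam_(n,x)(y) = x . lam_u^n(y), so M \ {1} sits in the semidirect
   product of (X, .) and Z.  Then K[M] is finitely generated over K[u] acting
   on the right; with N the order of lam_u, the element (N, u) is central; and
   (n, x) |-> t^n lam_(n,x) represents K[M] on K[t]^X.  A nilpotent element has
   trace 0 there, and only multiples of (kN, u) contribute to the coefficient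
   of t^(kN), by the factor |X|.  In a nilpotent ideal all coefficients vanish,
   because right multiplication moves each of them to some (kN, u).
   Any group of quotients G is then T x| <i(u)> with T a copy of (X, .); an
   element g whose coset generates G / T may replace i(u), and K[G] is the
   direct sum of the K[T] g^n. *)
Require Import Defs.
From HB Require Import structures.
From mathcomp Require Import all_boot all_fingroup all_algebra.
From mathcomp Require Import finmap boolp monalg.
Set Implicit Arguments.
Unset Strict Implicit.
Unset Printing Implicit Defensive.
Import GRing.Theory.
Local Open Scope ring_scope.

(** * Monoid algebras *)

Section SkewCoef.
Context (K : comNzRingType) (R : algType K) (G : monoidType).
Variable alpha : alg_action R G.
Local Notation A := (skew_alg alpha).

Definition scoef (x : G) (a : A) : R := mcoeff x (a : {malg R[G]}).
Definition sbase (x : G) (c : R) : A := mkmalgU x c.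

Fact scoef_is_linear x : linear (scoef x).
Proof.
move=> k a b; rewrite /scoef -skew_scaleE; exact: mcoeffD.
Qed.
HB.instance Definition _ x :=
  GRing.isLinear.Build K A R *:%R (scoef x) (scoef_is_linear x).

Fact sbase_is_linear x : linear (sbase x).
Proof.
move=> k a b; rewrite [LHS]monalgUD; congr (_ + _).
by rewrite [RHS]skew_scaleU.
Qed.
HB.instance Definition _ x :=
  GRing.isLinear.Build K R A *:%R (sbase x) (sbase_is_linear x).

Lemma scoef_base x y c : scoef x (sbase y c) = if y == x then c else 0.
Proof. by rewrite /scoef mcoeffU mulrb. Qed.

Lemma sbase_mul x y a b : sbase x a * sbase y b = sbase (x * y)%g (a * alpha x b).
Proof. exact: skew_mulUU. Qed.

Definition ssupp (a : A) : seq G := msupp (a : {malg R[G]}).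

Lemma ssupp_uniq a : uniq (ssupp a).
Proof. exact: fset_uniq. Qed.

Lemma mem_ssupp a x : (x \in ssupp a) = (scoef x a != 0).
Proof. by rewrite [RHS]mcoeff_neq0. Qed.

Lemma skew_expand (a : A) : a = \sum_(x <- ssupp a) sbase x (scoef x a).
Proof. exact: monalgE. Qed.

End SkewCoef.

Section MonoidAlg.
Context (K : comNzRingType) (G : monoidType).
Local Notation A := (monoid_alg K G).

Definition coef (x : G) (a : A) : K := scoef x a.

Fact coef_is_linear x : linear_for *%R (coef x).
Proof. by move=> k a b; rewrite /coef linearP. Qed.
HB.instance Definition _ x :=
  GRing.isLinear.Build K A K *%R (coef x) (coef_is_linear x).

Lemma coef_ext (a b : A) : (forall x, coef x a = coef x b) -> a = b.
Proof. by move=> ab; apply/malgP. Qed.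

Lemma coef_mbase x y : coef x (mbase K y) = (y == x)%:R.
Proof. by rewrite /coef [LHS]scoef_base; case: eqP. Qed.

Lemma sbaseZ x (c : K) : sbase (trivial_action K G) x c = c *: mbase K x.
Proof. by rewrite [RHS]skew_scaleU [_ *: _]mulr1. Qed.

Lemma mem_supp (a : A) x : (x \in ssupp a) = (coef x a != 0).
Proof. exact: mem_ssupp. Qed.

Lemma coef_expand (a : A) : a = \sum_(x <- ssupp a) coef x a *: mbase K x.
Proof. by rewrite {1}(skew_expand a); apply: eq_bigr => x _; rewrite sbaseZ. Qed.

Lemma coef_expandw (s : seq G) (a : A) : uniq s ->
    (forall x, coef x a != 0 -> x \in s) ->
  a = \sum_(x <- s) coef x a *: mbase K x.
Proof.
move=> s_uniq s_supp; apply: coef_ext => x; rewrite linear_sum /=.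
under eq_bigr => y _ do rewrite linearZ /= coef_mbase.
have [xs|xs] := boolP (x \in s).
  rewrite (bigD1_seq x) //= eqxx mulr1 big1 ?addr0 // => y.
  by move/negbTE->; rewrite mulr0.
rewrite big1_seq => [|y /= ys].
  by apply/eqP; apply: contraR xs; exact: s_supp.
by case: eqP ys xs => [-> ->|]; rewrite ?mulr0.
Qed.

Lemma mbase_inj : injective (@mbase K G).
Proof.
move=> x y /(congr1 (coef x)) /eqP; rewrite !coef_mbase eqxx.
by case: (y =P x) => // _; rewrite oner_eq0.
Qed.

Lemma mbaseX (x : G) n : mbase K (x ^+ n)%g = mbase K x ^+ n.
Proof. by elim: n => [|n IH]; rewrite ?mbase1 // expgS mbaseM IH exprS. Qed.

End MonoidAlg.
Arguments coef {K G} x a.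

(* Scalars are sent through [iota], so that the target only has to be a ring. *)
Section Lift.
Context (K : comNzRingType) (G : monoidType) (B : pzRingType).
Variables (iota : {rmorphism K -> B}) (f : G -> B).
Hypotheses (iotaC : forall k b, iota k * b = b * iota k) (f1 : f 1%g = 1)
  (fM : forall x y, f (x * y)%g = f x * f y).
Local Notation A := (monoid_alg K G).

Definition malg_lift (a : A) : B := \sum_(x <- ssupp a) iota (coef x a) * f x.

(** The list may exceed the support, which lets two elements and their combination be summed over
    one common list. *)
Lemma malg_liftw (s : seq G) (a : A) : uniq s ->
    (forall x, coef x a != 0 -> x \in s) ->
  malg_lift a = \sum_(x <- s) iota (coef x a) * f x.
Proof.
move=> s_uniq s_supp; rewrite /malg_lift.
rewrite [RHS](bigID (fun x => coef x a != 0)) /= [X in _ + X]big1 ?addr0.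
  rewrite -[RHS]big_filter; apply: perm_big; apply: uniq_perm.
  - exact: ssupp_uniq.
  - exact: filter_uniq.
  move=> x; rewrite mem_filter mem_supp.
  by case: (boolP (coef x a != 0)) => // /s_supp ->.
by move=> x; rewrite negbK => /eqP ->; rewrite rmorph0 mul0r.
Qed.

Lemma malg_lift_scaleD k (a b : A) :
  malg_lift (k *: a + b) = iota k * malg_lift a + malg_lift b.
Proof.
pose s := undup (ssupp a ++ ssupp b).
have sa x : coef x a != 0 -> x \in s.
  by rewrite mem_undup mem_cat mem_supp => ->.
have sb x : coef x b != 0 -> x \in s.
  by rewrite mem_undup mem_cat !mem_supp => ->; rewrite orbT.
have sab x : coef x (k *: a + b) != 0 -> x \in s.
  apply: contraR => xs; rewrite linearP /=.
  have /eqP -> : coef x a == 0 by apply: contraR xs; exact: sa.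
  have /eqP -> : coef x b == 0 by apply: contraR xs; exact: sb.
  by rewrite mulr0 addr0.
rewrite !(@malg_liftw s) ?undup_uniq // mulr_sumr -big_split /=.
by apply: eq_bigr => x _; rewrite linearP /= rmorphD rmorphM mulrDl mulrA.
Qed.

Lemma malg_lift_base x : malg_lift (mbase K x) = f x.
Proof.
rewrite (@malg_liftw [:: x]) // ?big_seq1 ?coef_mbase ?eqxx ?rmorph1 ?mul1r //.
by move=> y; rewrite coef_mbase inE (eq_sym y); case: (x =P y); rewrite ?eqxx.
Qed.

Fact malg_lift_additive : {morph malg_lift : a b / a - b}.
Proof.
move=> a b; rewrite addrC -scaleN1r malg_lift_scaleD rmorphN rmorph1.
by rewrite mulN1r addrC.
Qed.
HB.instance Definition _ :=
  GRing.isZmodMorphism.Build A B malg_lift malg_lift_additive.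

Lemma malg_liftZ k (a : A) : malg_lift (k *: a) = iota k * malg_lift a.
Proof. by rewrite -[k *: a]addr0 malg_lift_scaleD raddf0 addr0. Qed.

Fact malg_lift_monoid : monoid_morphism malg_lift.
Proof.
split=> [|a b]; first by rewrite -mbase1 malg_lift_base.
rewrite [a in LHS]coef_expand [b in LHS]coef_expand.
rewrite /(malg_lift a) /(malg_lift b) !mulr_suml raddf_sum /=.
apply: eq_bigr => x _; rewrite !mulr_sumr raddf_sum /=.
apply: eq_bigr => y _.
rewrite -scalerAl -scalerAr -mbaseM !malg_liftZ malg_lift_base fM.
by rewrite -!mulrA; congr (_ * _); rewrite !mulrA iotaC.
Qed.

End Lift.

Section LiftAlg.
Context (K : comNzRingType) (G : monoidType) (B : algType K).
Variable f : G -> B.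
Hypotheses (f1 : f 1%g = 1) (fM : forall x y, f (x * y)%g = f x * f y).
Local Notation A := (monoid_alg K G).

(** With [in_alg B] as [iota] the lift is also [K]-linear. The explicit sum is kept for reading off
    coefficients of images. *)
Lemma malg_lift_alg : exists F : {lrmorphism A -> B},
  (forall x, F (mbase K x) = f x) /\
  forall a, F a = \sum_(x <- ssupp a) coef x a *: f x.
Proof.
have iC (k : K) (b : B) : in_alg B k * b = b * in_alg B k.
  by rewrite /= -scalerAl -scalerAr mul1r mulr1.
pose F0 : A -> B := @malg_lift K G B (in_alg B) f.
have F0_rm : monoid_morphism F0 by exact: (malg_lift_monoid iC f1 fM).
have F0_lin : linear F0.
  by move=> k a b; rewrite /F0 malg_lift_scaleD /= -scalerAl mul1r.
pose Fm := GRing.isMonoidMorphism.Build A B F0 F0_rm.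
pose Fl := GRing.isLinear.Build K A B *:%R F0 F0_lin.
pose F : {lrmorphism A -> B} := HB.pack F0 Fm Fl.
exists F; split=> [x|a]; first exact: malg_lift_base.
by rewrite /= /F0 /malg_lift; apply: eq_bigr => x _; rewrite /= -scalerAl mul1r.
Qed.

End LiftAlg.

Section MonoidAlgMul.
Context (K : comNzRingType) (G : monoidType).
Local Notation A := (monoid_alg K G).

Lemma coef_mul_mbase (a : A) m z :
  coef z (a * mbase K m) = \sum_(x <- ssupp a) coef x a * (x * m == z)%g%:R.
Proof.
rewrite [a in LHS]coef_expand mulr_suml linear_sum /=; apply: eq_bigr => x _.
by rewrite -scalerAl -mbaseM linearZ /= coef_mbase.
Qed.

Lemma coef_mbase_mul (a : A) m z :
  coef z (mbase K m * a) = \sum_(x <- ssupp a) coef x a * (m * x == z)%g%:R.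
Proof.
rewrite [a in LHS]coef_expand mulr_sumr linear_sum /=; apply: eq_bigr => x _.
by rewrite -scalerAr -mbaseM linearZ /= coef_mbase.
Qed.

Let big_coef (a : A) z :
  \sum_(x <- ssupp a) coef x a * (x == z)%:R = coef z a.
Proof.
rewrite [in RHS](coef_expand a) linear_sum /=; apply: eq_bigr => x _.
by rewrite linearZ /= coef_mbase.
Qed.

Lemma coef_mulr_inj (a : A) m z : injective (fun x : G => x * m)%g ->
  coef (z * m)%g (a * mbase K m) = coef z a.
Proof.
move=> m_inj; rewrite coef_mul_mbase -[RHS]big_coef.
by apply: eq_bigr => x _; rewrite (inj_eq m_inj).
Qed.

Lemma coef_mull_inj (a : A) m z : injective (fun x : G => m * x)%g ->
  coef (m * z)%g (mbase K m * a) = coef z a.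
Proof.
move=> m_inj; rewrite coef_mbase_mul -[RHS]big_coef.
by apply: eq_bigr => x _; rewrite (inj_eq m_inj).
Qed.

Lemma coef_mul_neq0 (a : A) m z :
  coef z (a * mbase K m) != 0 -> exists2 x, coef x a != 0 & (x * m)%g = z.
Proof.
rewrite coef_mul_mbase => nz.
have [/hasP[x xa /eqP e] | /hasPn no] := boolP (has (fun x => (x * m)%g == z) (ssupp a)).
  by exists x => //; rewrite -mem_supp.
case/eqP: nz; apply: big1_seq => x /= /no /negbTE ->; exact: mulr0.
Qed.

Lemma in_center_mbase (a : A) :
  (forall m, a * mbase K m = mbase K m * a) -> in_center a.
Proof.
move=> aC b; rewrite (coef_expand b) mulr_sumr mulr_suml; apply: eq_bigr => x _.
by rewrite -scalerAr -scalerAl aC.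
Qed.

Lemma mul_right_annihilated (a b : A) :
  (forall m, m <> 1%g -> a * mbase K m = 0) -> a * b = coef 1%g b *: a.
Proof.
move=> a0; pose s := undup (1%g :: ssupp b).
rewrite [b in LHS](@coef_expandw _ _ s) ?undup_uniq //; last first.
  by move=> x xb; rewrite mem_undup inE mem_supp xb orbT.
rewrite mulr_sumr (bigD1_seq 1%g) ?undup_uniq ?mem_undup ?mem_head //=.
rewrite big1 ?addr0 => [|m /eqP m1]; rewrite -scalerAr; first by rewrite mulr1.
by rewrite a0 // scaler0.
Qed.

End MonoidAlgMul.

(** * Noetherianity over K[s], and traces of nilpotent matrices *)

Section Noetherian.
Variable K : fieldType.

(** A nonzero polynomial [p] of least size in the whole chain divides, by Euclidean division, every
    element of the ideals from its index [N] on. *)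
Lemma poly_ideal_chain (J : nat -> {poly K} -> Prop) :
    (forall n, J n 0) ->
    (forall n p q, J n p -> J n q -> J n (p + q)) ->
    (forall n p q, J n p -> J n (p * q)) ->
    (forall m n p, (m <= n)%N -> J m p -> J n p) ->
  exists N, forall n p, (N <= n)%N -> J n p -> J N p.
Proof.
move=> J0 JD JM J_mono.
pose P k := `[<exists n p, [/\ J n p, p != 0 & size p = k]>].
have [exP | noP] := pselect (exists k, P k); last first.
  exists 0%N => n p _ Jp; have [->|p0] := eqVneq p 0; first exact: J0.
  by case: noP; exists (size p); apply/asboolP; exists n, p.
case: (ex_minnP exP) => k /asboolP[N [p [Jp p0 sp]]] p_min.
exists N => n q Nn Jq; rewrite (divp_eq q p).
have [->|r0] := eqVneq (q %% p) 0; first by rewrite addr0 mulrC; exact: JM.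
have /p_min : P (size (q %% p)).
  apply/asboolP; exists n, (q %% p); split=> //.
  have ->: q %% p = q + p * - (q %/ p).
    by rewrite mulrN [p * _]mulrC {2}(divp_eq q p) addrC addrA addNr add0r.
  by apply: JD => //; apply: JM; exact: J_mono Jp.
by rewrite -sp leqNgt ltn_modp p0.
Qed.

Section PolySpan.
Context (R : algType K) (s : R) (gs : seq R).

Definition poly_span (a : R) : Prop := exists p : nat -> {poly K},
  a = \sum_(i < size gs) gs`_i * horner_alg s (p i).

Lemma poly_span_gen j q : (j < size gs)%N -> poly_span (gs`_j * horner_alg s q).
Proof.
move=> js; exists (fun i => if i == j then q else 0).
rewrite (bigD1 (Ordinal js)) //= eqxx big1 ?addr0 // => i ij.
by rewrite ifN ?rmorph0 ?mulr0.
Qed.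

Lemma poly_span_genX g n : g \in gs -> poly_span (g * s ^+ n).
Proof.
move=> g_gs; rewrite -(nth_index 0 g_gs) -[s](horner_algX s) -rmorphXn.
by apply: poly_span_gen; rewrite index_mem.
Qed.

Lemma poly_spanZD k a b : poly_span a -> poly_span b -> poly_span (k *: a + b).
Proof.
move=> [p ->] [q ->]; exists (fun i => p i * k%:P + q i).
rewrite scaler_sumr -big_split /=; apply: eq_bigr => i _.
by rewrite rmorphD rmorphM /= horner_algC mulrDr mulrA mulr_algr.
Qed.

Lemma poly_span0 : poly_span 0.
Proof. by exists (fun=> 0); rewrite big1 // => i _; rewrite rmorph0 mulr0. Qed.

(** Right ideals are right modules over the image of [{poly K}]. Induction on the number of
    generators in use reduces the chain to ideals of coefficients, which stabilise by
    [poly_ideal_chain]. *)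
Lemma right_noetherian_poly_span : (forall a, poly_span a) -> right_noetherian R.
Proof.
move=> gen I I_id I_step.
have I_mono m n a : (m <= n)%N -> I m a -> I n a.
  elim: n => [|n IH]; first by rewrite leqn0 => /eqP ->.
  by rewrite leq_eqVlt => /predU1P[-> // | /IH Ia /Ia]; exact: I_step.
have ID n a b : I n a -> I n b -> I n (a + b) by case: (I_id n) => _ + _; exact.
have IM n a b : I n a -> I n (a * b) by case: (I_id n) => _ _; exact.
have I0 n : I n 0 by case: (I_id n).
pose comb k (p : nat -> {poly K}) := \sum_(i < k) gs`_i * horner_alg s (p i).
have combD k p q : comb k p + comb k q = comb k (fun i => p i + q i).
  by rewrite -big_split /=; apply: eq_bigr => i _; rewrite rmorphD mulrDr.
have combM k p q : comb k p * horner_alg s q = comb k (fun i => p i * q).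
  by rewrite mulr_suml; apply: eq_bigr => i _; rewrite rmorphM mulrA.
have comb0 k : comb k (fun=> 0) = 0.
  by apply: big1 => i _; rewrite rmorph0 mulr0.
suff /(_ (size gs))[N NP] : forall k, exists N, forall n p,
    (N <= n)%N -> I n (comb k p) -> I N (comb k p).
  by exists N => n a Nn; have [p ->] := gen a; exact: NP.
elim=> [|k [N1 N1P]]; first by exists 0%N => n p _; rewrite /comb !big_ord0.
(* All possible last coefficients of elements of [I n] spanned by the first [k.+1] generators;
   expansions need not be unique. *)
pose J n q := exists p, I n (comb k p + gs`_k * horner_alg s q).
have [N2 N2P] : exists N, forall n p, (N <= n)%N -> J n p -> J N p.
  apply: poly_ideal_chain.
  - by move=> n; exists (fun=> 0); rewrite comb0 rmorph0 mulr0 addr0.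
  - move=> n q1 q2 [p1 I1] [p2 I2]; exists (fun i => p1 i + p2 i).
    by rewrite -combD rmorphD mulrDr addrACA; exact: ID.
  - move=> n q1 q2 [p1 I1]; exists (fun i => p1 i * q2).
    by rewrite -combM rmorphM mulrA -mulrDl; exact: IM.
  - by move=> m n q mn [p Ip]; exists p; exact: I_mono Ip.
exists (maxn N1 N2) => n p; rewrite geq_max => /andP[le1 le2].
have ->: comb k.+1 p = comb k p + gs`_k * horner_alg s (p k).
  by rewrite /comb big_ord_recr.
move=> Ip.
(* An element of [I N2] with the same last coefficient; subtracting it leaves a combination of the
   first [k] generators, to which the induction hypothesis applies. *)
have [p' Ip'] := N2P _ _ le2 (ex_intro _ p Ip : J n (p k)).
have diff : comb k p - comb k p' = comb k (fun i => p i - p' i).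
  by rewrite -combD; congr (_ + _); rewrite -sumrN; apply: eq_bigr => i _;
     rewrite rmorphN mulrN.
have Id : I N1 (comb k (fun i => p i - p' i)).
  apply: (N1P n) => //; rewrite -diff.
  have ->: comb k p - comb k p' = comb k p + gs`_k * horner_alg s (p k)
      + (comb k p' + gs`_k * horner_alg s (p k)) * (-1).
    by rewrite mulrN1 opprD addrACA subrr addr0.
  by apply: ID => //; apply: IM; exact: I_mono Ip'.
rewrite -(subrK (comb k p') (comb k p)) diff -addrA.
by apply: ID; [apply: I_mono Id | apply: I_mono Ip']; rewrite leq_max leqnn ?orbT.
Qed.

End PolySpan.
End Noetherian.

(** As [A ^+ k = 0], the matrix ['X - A] divides the scalar matrix ['X^k]. Taking determinants,
    [char_poly A] divides a power of ['X], so it is itself one, and its subleading coefficient is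
    minus the trace. *)
Lemma mxtrace_nilpotent (R : idomainType) n (A : 'M[R]_n) k :
  A ^+ k = 0 -> \tr A = 0.
Proof.
case: n A => [|n] A Ak; first by rewrite /mxtrace big_ord0.
pose B : 'M[{poly R}]_n.+1 := map_mx polyC A.
have Bk : B ^+ k = 0 by rewrite -rmorphXn /= Ak map_mx0.
have com : GRing.comm ('X%:M : 'M[{poly R}]_n.+1) B by apply/esym; exact: scalar_mxC.
have Xk : 'X%:M ^+ k = ('X^k)%:M :> 'M[{poly R}]_n.+1 by rewrite rmorphXn.
have := subrXX_comm k com; rewrite Bk subr0 Xk => /(congr1 determinant).
rewrite det_scalar det_mulmx -exprM -/(char_poly_mx A) -/(char_poly A) => eX.
have : char_poly A %| ('X - 0%:P) ^+ (k * n.+1) by rewrite subr0 eX dvdp_mulr.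
case/dvdp_exp_XsubCP => m _; rewrite subr0 eqp_monic ?char_poly_monic ?monicXn //.
move=> /eqP eA.
have := size_char_poly A; rewrite eA size_polyXn => -[em].
have := char_poly_trace A isT.
rewrite eA em coefXn /= (ltn_eqF (ltnSn n)) => /esym/eqP.
by rewrite oppr_eq0 => /eqP.
Qed.

(** * Normal form in the structure monoid *)

Section AdditiveNormalForm.
Variable X : finType.

Lemma agenX (x : X) n : (agen x ^+ n)%g = pword _ (nseq n x) :> additive_monoid X.
Proof. by elim: n => // n IH; rewrite expgS IH pword_mul. Qed.

(** The relation [x + y = y + y] preserves both the length and the last letter of a word. *)
Lemma agenX_inj n m (x y : X) :
  (agen x ^+ n.+1 = agen y ^+ m.+1)%g -> n = m /\ x = y.
Proof.
rewrite !agenX => /pword_eq cong; split.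
  by have /eqP := additive_mcong_size cong; rewrite !size_nseq eqSS => /eqP.
have last_nseq d z k : last d (nseq k.+1 z) = z :> X by elim: k d => //= k IH.
have last_cong u v : mcong (@additive_rel X) u v -> forall d, last d u = last d v.
  elim=> {u v cong} [u v [a [b [-> ->]]] // | // | // | u w v _ IH1 _ IH2 d |
    u u' v v' _ IH1 _ IH2 d]; first by rewrite IH1.
  by rewrite !last_cat IH1 IH2.
by have := last_cong _ _ cong x; rewrite !last_nseq.
Qed.

End AdditiveNormalForm.

(** * Multiplication in the coordinates degree and point *)

Section Structure.
Variables (X : finType) (r : X * X -> X * X).
Local Notation M := (structure_monoid r).
Local Notation gen := (mgen r).

(* The element of [M] that [pi] sends to [n.+1 x]. *)
Fixpoint elt (n : nat) (x : X) : M :=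
  if n is n'.+1 then (elt n' x * gen (finv (lamM (elt n' x)) x))%g else gen x.

Hypotheses (ybe : yang_baxter r) (lnd : left_nondegenerate r)
  (idem : idempotent_map r).

Let lamM_inj (m : M) : injective (lamM m) := bij_inj (lamM_bij lnd m).
Let lamX_inj x : injective (lam r x) := bij_inj (lnd x).

Lemma lamM_one : lamM (1 : M)%g =1 id.
Proof. by move=> y; rewrite /lamM (lamw_cong ybe (mcong_prepr _ _)). Qed.

Lemma lam_diag x : lam r x (diag r x) = x.
Proof. exact: f_finv. Qed.

(** The injective map [lam r (lam r x y)] sends both sides to [lam r x y]: the left by idempotence,
    the right by definition of [diag]. *)
Lemma rho_diag x y : rho r y x = diag r (lam r x y).
Proof.
by apply: (@lamX_inj (lam r x y)); rewrite lam_diag lam_rho.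
Qed.

Lemma finv_lam_mgen x : finv (lamM (gen x)) x = diag r x.
Proof.
by apply: (@lamX_inj x); rewrite lam_diag -(lamM_mgen ybe) f_finv.
Qed.

Lemma mgen_mul x y : (gen x * gen y)%g = elt 1 (lam r x y).
Proof.
rewrite /= !pword_mul; apply/pword_eq/mcong_gen; exists x, y; split=> //.
by rewrite rho_diag -finv_lam_mgen.
Qed.

Lemma elt_mgen n x y : (elt n x * gen y)%g = elt n.+1 (lamM (elt n x) y).
Proof.
elim: n x y => [|n IH] x y; first by rewrite mgen_mul lamM_mgen.
rewrite [elt n.+1 x]/=; set a := finv _ _; set b := lam r a y.
have lam_xy : lamM (elt n x * gen a)%g y = lamM (elt n x) b.
  by rewrite lamM_mul //= lamM_mgen.
rewrite lam_xy; set z := lamM (elt n x) b.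
(* The last two letters multiply to [b] followed by [diag r b], and the induction hypothesis absorbs
   [b] into [elt n x]. *)
have xay : (elt n x * gen a * gen y)%g = (elt n.+1 z * gen (diag r b))%g.
  rewrite -mulgA mgen_mul -/b -finv_lam_mgen mulgA IH.
  by rewrite -/z.
rewrite xay [in RHS]/=; congr (_ * gen _)%g.
(* It remains to see that [diag r b] is the last letter prescribed by [elt], that is, that
   [lamM (elt n.+1 z)] sends it to [z]. *)
apply: (@lamM_inj (elt n.+1 z)); rewrite f_finv //.
have -> : elt n.+1 z = (elt n x * gen b)%g by rewrite IH.
by rewrite lamM_mul //= lamM_mgen // lam_diag.
Qed.

Lemma elt_mul n x m y :
  (elt n x * elt m y)%g = elt (n + m).+1 (lamM (elt n x) y).
Proof.
elim: m => [|m IH]; first by rewrite addn0 elt_mgen.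
rewrite [elt m.+1 y]/= mulgA IH elt_mgen addnS; congr (elt _ _).
by rewrite -IH lamM_mul //= f_finv.
Qed.

Lemma piM_elt n x : piM (elt n x) = (agen x ^+ n.+1)%g.
Proof.
elim: n => [|n IH]; first by rewrite piM_mgen // expg1.
by rewrite /= piM_mul // IH piM_mgen // aext_gen f_finv // -expgSr.
Qed.

Lemma elt_inj n m x y : elt n x = elt m y -> n = m /\ x = y.
Proof. by move=> /(congr1 (@piM X r)); rewrite !piM_elt => /agenX_inj. Qed.

Lemma piM_one : piM (1 : M)%g = 1%g.
Proof. by rewrite /piM (piw_cong ybe idem (mcong_prepr _ _)). Qed.

Definition degM (m : M) : nat := adeg (piM m).

Lemma degM_elt n x : degM (elt n x) = n.+1.
Proof. by rewrite /degM piM_elt agenX adegE size_nseq. Qed.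

Lemma degM_one : degM 1%g = 0%N.
Proof. by rewrite /degM piM_one adegE. Qed.

Lemma elt_neq1 n x : elt n x <> 1%g.
Proof. by move/(congr1 degM); rewrite degM_elt degM_one. Qed.

Lemma elt_eq1 n x : (elt n x == 1%g) = false.
Proof. by apply/eqP; exact: elt_neq1. Qed.

Lemma eltP (m : M) : m = 1%g \/ exists n x, m = elt n x.
Proof.
rewrite -(preprK m); elim/last_ind: (prepr m) => [|w x IH]; first by left.
right; rewrite -cats1 -pword_mul; case: IH => [-> | [n [y ->]]].
  by exists 0%N, x; rewrite mul1g.
by rewrite elt_mgen; do 2!eexists.
Qed.

Lemma degM_mul (m m' : M) : degM (m * m')%g = (degM m + degM m')%N.
Proof.
have [-> | [n [x ->]]] := eltP m; first by rewrite mul1g degM_one.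
have [-> | [k [y ->]]] := eltP m'; first by rewrite mulg1 degM_one addn0.
by rewrite elt_mul !degM_elt addnS.
Qed.

Lemma elt_mull_inj n x : injective (fun m : M => elt n x * m)%g.
Proof.
move=> m m' /= e.
have := congr1 degM e; rewrite !degM_mul => /addnI.
have [-> | [k [y em]]] := eltP m; have [-> | [k' [y' em']]] := eltP m' => //.
- by rewrite em' degM_elt degM_one.
- by rewrite em degM_elt degM_one.
by move: e; rewrite em em' !elt_mul => /elt_inj[_ /lamM_inj ->];
   rewrite !degM_elt => -[->].
Qed.

(** The last letter of [elt n.+1 x] is the point [t] that [lamM (elt n x)] sends to [x]. Since
    [lam r t (diag r t) = t], each new letter applies [diag] once more. *)
Lemma elt_type n x : finv (lamM (elt n x)) x = iter n.+1 (diag r) x.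
Proof.
elim: n => [|n IH].
  by apply: (@lamM_inj (elt 0 x)); rewrite f_finv //= lamM_mgen // lam_diag.
rewrite iterS -IH; apply: (@lamM_inj (elt n.+1 x)); rewrite f_finv //.
by rewrite lamM_mul //= lamM_mgen // lam_diag f_finv.
Qed.

Lemma SsubE u n x : Ssub r u (elt n x) <-> iter n.+1 (diag r) x = u.
Proof.
rewrite /Ssub piM_elt agenX aextE adegE size_nseq map_nseq elt_type.
rewrite -!agenX; split=> [[_ /agenX_inj[_]] // | ->].
by split=> //; exact: elt_neq1.
Qed.

(* By [SsubE], the class [S_u] of a product is that of its right factor. *)
Lemma diag_mul n x m y :
  iter (n + m).+2 (diag r) (lamM (elt n x) y) = iter m.+1 (diag r) y.
Proof.
rewrite -!elt_type.
apply: (@lamM_inj (elt (n + m).+1 (lamM (elt n x) y))); rewrite f_finv //.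
by rewrite -elt_mul lamM_mul //= f_finv.
Qed.

Lemma diag_lam x y : diag r (diag r (lam r x y)) = diag r y.
Proof. by have := diag_mul 0 x 0 y; rewrite /= lamM_mgen. Qed.

(* [x |-> lam x ^-1 z] is onto as soon as it is injective, and all its values
   have the same image under [diag] by [diag_lam]. *)
Lemma diag_const :
    (forall z x x', finv (lam r x) z = finv (lam r x') z -> x = x') ->
  forall y y', diag r y = diag r y'.
Proof.
move=> inj y y'; pose f x := finv (lam r x) y.
have f_inj : injective f by move=> x x'; exact: inj.
have key z : diag r z = diag r (diag r y).
  by rewrite -[z](f_finv f_inj) -(diag_lam (finv f z)) {2}/f f_finv.
by rewrite key [RHS]key.
Qed.

Lemma card_Lambda1P : (0 < #|X|)%N ->
  (#|Lambda r| = 1%N) <-> exists u, forall x, diag r x = u.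
Proof.
move=> /card_gt0P[x0 _]; split=> [/eqP/cards1P[u eu] | [u du]].
  exists u => x; apply/set1P; rewrite -eu; exact: imset_f.
apply/eqP/cards1P; exists u; apply/setP => y.
by apply/imsetP/set1P => [[x _ ->] // | ->]; exists x0.
Qed.

End Structure.

(** * Non-constant diagonal map *)

Section NonConstantDiag.
Variables (X : finType) (r : X * X -> X * X).
Local Notation M := (structure_monoid r).
Local Notation gen := (mgen r).
Hypotheses (ybe : yang_baxter r) (lnd : left_nondegenerate r)
  (idem : idempotent_map r).

Let lamX_inj x : injective (lam r x) := bij_inj (lnd x).

Lemma mgen_inj : injective gen.
Proof. by move=> x y; rewrite -!/(elt r 0 _) => /(elt_inj ybe lnd idem)[]. Qed.

(** If [lam r x] and [lam r x'] take the same [y] to [z], then [gen x * gen y] and [gen x' * gen y]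
    both equal [elt r 1 z]; cancel [gen y]. *)
Lemma diag_const_cancellative :
  cancellative M -> forall y y', diag r y = diag r y'.
Proof.
case=> _ rcancel; apply: diag_const => // z x x' e.
apply: mgen_inj; apply: (rcancel (gen (finv (lam r x) z))).
by rewrite {2}e !mgen_mul // !f_finv.
Qed.

(** From the equal products [gen x * gen y] and [gen x' * gen y], applying [lamM] and undoing
    [lam r y] gives [lam r x =1 lam r x']. *)
Lemma diag_const_lam_inj : (forall x x', lam r x =1 lam r x' -> x = x') ->
  forall y y', diag r y = diag r y'.
Proof.
move=> lam_inj; apply: diag_const => // z x x' e; apply: lam_inj => w.
pose y := finv (lam r x) z.
have : (gen x * gen y)%g = (gen x' * gen y)%g :> M.
  by rewrite {2}/y e !mgen_mul // !f_finv.
move/(congr1 (fun m => lamM m (finv (lam r y) w))).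
by rewrite !(lamM_mul ybe) /= !(lamM_mgen ybe) f_finv.
Qed.

Hypothesis not_const : ~ forall y y', diag r y = diag r y'.

(** Degree one is the contrapositive of [diag_const_lam_inj]. Left multiplication by [gen x] then
    carries a collision to the next degree, with the points kept apart by injectivity of
    [lam r x]. *)
Lemma lamM_collision n : exists x x',
  x != x' /\ lamM (elt r n x) =1 lamM (elt r n x').
Proof.
elim: n => [|n [x [x' [xx' e]]]].
  apply: contrapT => none; apply: not_const; apply: diag_const_lam_inj => x x' e.
  apply/eqP/negP => /negP xx'; apply: none; exists x, x'; split=> // y.
  by rewrite /= !(lamM_mgen ybe).
exists (lam r x x), (lam r x x'); rewrite (inj_eq (@lamX_inj x)); split=> // y.
have lamM_next z : lamM (elt r n.+1 (lam r x z)) y = lam r x (lamM (elt r n z) y).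
  rewrite -!(lamM_mgen ybe) -[RHS](lamM_mul ybe).
  by have := elt_mul ybe lnd idem 0 x n z; rewrite add0n /= => ->; rewrite lamM_mgen.
by rewrite !lamM_next e.
Qed.

Section Algebra.
Variable K : fieldType.
Local Notation KM := (monoid_alg K M).

(** Right multiplication by [b] scales such an element by the coefficient of [b] at the unit. The
    first clause therefore makes the product of two of them zero. *)
Definition left_annihilator (a : KM) : Prop :=
  coef 1%g a = 0 /\ forall m, m <> 1%g -> a * mbase K m = 0.

Lemma left_annihilatorM a b :
  left_annihilator a -> a * b = coef 1%g b *: a.
Proof. by case=> _; exact: mul_right_annihilated. Qed.

Lemma left_annihilatorZ k a : left_annihilator a -> left_annihilator (k *: a).
Proof.
case=> a1 a0; split=> [|m /a0 am]; first by rewrite linearZ /= a1 mulr0.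
by rewrite -scalerAl am scaler0.
Qed.

Lemma left_annihilatorD a b :
  left_annihilator a -> left_annihilator b -> left_annihilator (a + b).
Proof.
move=> [a1 a0] [b1 b0]; split=> [|m m1]; first by rewrite linearD /= a1 b1 addr0.
by rewrite mulrDl a0 ?b0 ?addr0.
Qed.

Lemma left_annihilator0 : left_annihilator 0.
Proof. by split=> [|m _]; rewrite ?linear0 ?mul0r. Qed.

Lemma left_annihilator_mull a b : left_annihilator a -> left_annihilator (b * a).
Proof.
case=> a1 a0; split=> [|m m1]; last by rewrite -mulrA a0 ?mulr0.
rewrite (coef_expand b) mulr_suml linear_sum big1 // => m _.
rewrite -scalerAl linearZ /=.
have [-> | [n [x ->]]] := eltP ybe lnd idem m; first by rewrite mul1r a1 mulr0.
rewrite coef_mbase_mul big1 ?mulr0 // => y _.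
have [/(congr1 (@degM X r)) | _] := (elt r n x * y)%g =P 1%g; last exact: mulr0.
by rewrite degM_mul // degM_elt // degM_one.
Qed.

(** By [elt_mul], the left factor [elt r n x] enters a product only through [n] and its map
    [lamM]. *)
Lemma collision_annihilator n x x' : lamM (elt r n x) =1 lamM (elt r n x') ->
  left_annihilator (mbase K (elt r n x) - mbase K (elt r n x')).
Proof.
move=> e; split=> [|m m1].
  by rewrite linearB /= !coef_mbase !elt_eq1 // subrr.
have [//|[k [y ->]]] := eltP ybe lnd idem m.
by rewrite mulrBl -!mbaseM !elt_mul // e subrr.
Qed.

Lemma not_semiprime_nonconst : ~ semiprime KM.
Proof.
move=> sp; have [x [x' [xx' e]]] := lamM_collision 0.
have [ideal nil] : two_sided_ideal left_annihilator /\ nilpotent_ideal left_annihilator.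
  split.
    split; last by move=> a b; exact: left_annihilator_mull.
    split; [exact: left_annihilator0 | exact: left_annihilatorD |].
    by move=> a b aA; rewrite (left_annihilatorM _ aA); exact: left_annihilatorZ.
  exists 2 => s sA; rewrite big_ord_recl big_ord1 (left_annihilatorM _ (sA _)).
  by case: (sA (lift ord0 ord0)) => -> _; rewrite scale0r.
have /eqP := sp _ ideal nil _ (collision_annihilator e).
rewrite subr_eq0 => /eqP/mbase_inj/(elt_inj ybe lnd idem)[_ exx].
by rewrite exx eqxx in xx'.
Qed.

Lemma not_noetherian_nonconst : ~ right_noetherian KM.
Proof.
(* Annihilators supported in degrees at most [n], because [elt r k x] has degree [k.+1]. A collision
   at index [N] lies in [I N.+1] but not in [I N]. *)
pose I n a := left_annihilator a /\
  forall k x, (n <= k)%N -> coef (elt r k x) a = 0.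
move=> /(_ I)[] => [n | n a [aA a0] | N NP].
- split; first by split=> [|k x _]; [exact: left_annihilator0 | exact: linear0].
    move=> a b [aA a0] [bA b0]; split; first exact: left_annihilatorD.
    by move=> k x nk; rewrite linearD /= a0 ?b0 ?addr0.
  move=> a b [aA a0]; rewrite (left_annihilatorM _ aA); split.
    exact: left_annihilatorZ.
  by move=> k x nk; rewrite linearZ /= a0 ?mulr0.
- by split=> // k x nk; apply: a0; exact: ltnW.
have [x [x' [xx' e]]] := lamM_collision N.
have /NP : I N.+1 (mbase K (elt r N x) - mbase K (elt r N x')).
  split=> [|k y Nk]; first exact: collision_annihilator.
  have ne z : (elt r N z == elt r k y) = false.
    by apply/eqP => /(elt_inj ybe lnd idem)[eN _]; rewrite eN ltnn in Nk.
  by rewrite linearB /= !coef_mbase !ne subrr.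
case/(_ (leqnSn N)) => _ /(_ N x (leqnn N)).
rewrite linearB /= !coef_mbase eqxx.
case: (elt r N x' =P _) => [/(elt_inj ybe lnd idem)[_ exx]|_]; first by rewrite exx eqxx in xx'.
by rewrite subr0 => /eqP; rewrite oner_eq0.
Qed.

(** Suppose [elt r n x] occurs in a central [a]. Left cancellation makes [gen y * elt r n x] occur
    in [a * mbase K (gen y)], so it also has right factor [gen y]. By [diag_mul] the two right
    factors have the same type, hence [diag r y] would not depend on [y]. *)
Lemma central_nonconst : central_alg KM.
Proof.
move=> a aC; exists (coef 1%g a); apply: coef_ext => m.
have [-> | [n [x ->]]] := eltP ybe lnd idem m.
  by rewrite linearZ /= -mbase1 coef_mbase eqxx mulr1.
rewrite linearZ /= -mbase1 coef_mbase eq_sym elt_eq1 // mulr0.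
apply: contrapT => /eqP nz; apply: not_const.
suff type y : diag r y = iter n.+1 (diag r) x by move=> y y'; rewrite !type.
have : coef (gen y * elt r n x)%g (a * mbase K (gen y)) != 0.
  by rewrite aC coef_mull_inj //; exact: (elt_mull_inj ybe lnd idem (n := 0)).
case/coef_mul_neq0 => m' _ e; have := congr1 (@degM X r) e.
have [em' | [k [z em']]] := eltP ybe lnd idem m'.
  by rewrite em' mul1g -[gen y]/(elt r 0 y) degM_mul // !degM_elt.
move: e; rewrite em' -!/(elt r 0 _) !elt_mul // => /(elt_inj ybe lnd idem).
rewrite addn0 add0n => -[[ekn] ez] _.
have := diag_mul ybe lnd idem k z 0 y; rewrite addn0 ez ekn -[iter 1 _ y]/(diag r y) => <-.
by rewrite -(diag_mul ybe lnd idem 0 y n x) add0n.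
Qed.

End Algebra.
End NonConstantDiag.

(** * Constant diagonal map *)

Section ConstantDiag.
Variables (X : finType) (r : X * X -> X * X).
Local Notation M := (structure_monoid r).
Local Notation gen := (mgen r).
Hypotheses (ybe : yang_baxter r) (lnd : left_nondegenerate r)
  (idem : idempotent_map r).
Variable u : X.
Hypothesis diag_u : forall x, diag r x = u.

Let lamM_inj (m : M) : injective (lamM m) := bij_inj (lamM_bij lnd m).
Let lamX_inj x : injective (lam r x) := bij_inj (lnd x).

Lemma lam_u x : lam r x u = x.
Proof. by rewrite -(diag_u x) lam_diag. Qed.

Lemma lam_lam x y z : lam r x (lam r y z) = lam r (lam r x y) (lam r u z).
Proof. by rewrite (lam_comp ybe) rho_diag // diag_u. Qed.

Definition dotX (x y : X) : X := lam r x (finv (lam r u) y).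
Definition dot_inv (x : X) : X := finv (dotX x) u.

Lemma dot_lam x y : dotX x (lam r u y) = lam r x y.
Proof. by rewrite /dotX finv_f. Qed.

Let dot_inj x : injective (dotX x).
Proof. by move=> y z /lamX_inj /(can_inj (f_finv (@lamX_inj u))). Qed.

Lemma dotx1 x : dotX x u = x.
Proof. by rewrite -{1}(lam_u u) dot_lam lam_u. Qed.

Lemma dot1x x : dotX u x = x.
Proof. by rewrite /dotX f_finv. Qed.

Lemma dot_morph x y : lam r u (dotX x y) = dotX (lam r u x) (lam r u y).
Proof. by rewrite dot_lam {1}/dotX lam_lam f_finv. Qed.

(** Writing [y] as an image under [lam r u] and [z] as a double image turns the claim into
    [lam_lam]. *)
Lemma dotA : associative dotX.
Proof.
move=> x y z; rewrite -(f_finv (@lamX_inj u) y) -(f_finv (@lamX_inj u) z).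
set y' := finv _ y; set z' := finv _ z; rewrite -dot_morph !dot_lam.
by rewrite -(f_finv (@lamX_inj u) z') -lam_lam {1}/dotX !finv_f.
Qed.

Lemma dotxV : right_inverse u dot_inv dotX.
Proof. by move=> x; rewrite /dot_inv f_finv. Qed.

Lemma dotVx : left_inverse u dot_inv dotX.
Proof.
move=> x; rewrite -[x in dotX _ x]dotx1 -(dotxV (dot_inv x)).
by rewrite [dotX x _]dotA dotxV dot1x dotxV.
Qed.

Lemma dot_is_group : is_group dotX.
Proof.
split; first exact: dotA.
by exists u, dot_inv; split; [exact: dot1x | exact: dotx1 | exact: dotVx | exact: dotxV].
Qed.

Lemma eltS n x : elt r n.+1 x = (elt r n x * gen u)%g.
Proof. by rewrite /= elt_type // iterS diag_u. Qed.

Lemma lamM_elt n x y : lamM (elt r n x) y = dotX x (iter n.+1 (lam r u) y).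
Proof.
elim: n y => [|n IH] y; first by rewrite lamM_mgen //= dot_lam.
by rewrite eltS lamM_mul //= lamM_mgen // IH -iterSr.
Qed.

Lemma elt_expg n x : elt r n x = (gen x * gen u ^+ n)%g.
Proof.
by elim: n => [|n IH]; rewrite ?mulg1 // eltS IH -mulgA -expgSr.
Qed.

Lemma lamM_elt_u n x : lamM (elt r n x) u = x.
Proof.
by rewrite lamM_elt iter_fix ?lam_u // dotx1.
Qed.

Lemma lamM_elt_inj n x x' y : lamM (elt r n x) y = lamM (elt r n x') y -> x = x'.
Proof.
rewrite !lamM_elt; set z := iter _ _ _ => /(congr1 (fun w => dotX w (dot_inv z))).
by rewrite -!dotA dotxV !dotx1.
Qed.

Lemma structure_mulr_inj (m : M) : injective (fun a : M => a * m)%g.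
Proof.
move=> a b /= e; have := congr1 (@degM X r) e; rewrite !degM_mul // => /addIn.
have [-> | [n [x ea]]] := eltP ybe lnd idem a.
  have [-> // | [k [y ->]]] := eltP ybe lnd idem b.
  by rewrite degM_elt // degM_one.
have [-> | [k [y eb]]] := eltP ybe lnd idem b.
  by rewrite ea degM_elt // degM_one.
rewrite ea eb !degM_elt // => -[enk]; congr (elt r _ _) => //.
have [em | [l [z em]]] := eltP ybe lnd idem m.
  by move: e; rewrite em !mulg1 ea eb => /(elt_inj ybe lnd idem)[].
move: e; rewrite em ea eb !elt_mul // enk => /(elt_inj ybe lnd idem)[_].
exact: lamM_elt_inj.
Qed.

Lemma structure_mull_inj (m : M) : injective (fun a : M => m * a)%g.
Proof.
have [-> | [n [x ->]]] := eltP ybe lnd idem m; last exact: elt_mull_inj.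
by move=> a b; rewrite !mul1g.
Qed.

Lemma structure_cancellative : cancellative M.
Proof.
by split=> a b c; [exact: structure_mull_inj | exact: structure_mulr_inj].
Qed.

Let N := #[perm (@lamX_inj u)]%g.

Lemma lam_order_gt0 : (0 < N)%N.
Proof. exact: order_gt0. Qed.

Lemma lamM_elt_order k : (N %| k.+1)%N -> lamM (elt r k u) =1 id.
Proof.
move=> Nk y; rewrite lamM_elt dot1x.
have -> : iter k.+1 (lam r u) y = ((perm (@lamX_inj u)) ^+ k.+1)%g y.
  by rewrite permX; apply: eq_iter => z; rewrite permE.
by have /dvdnP[q ->] := Nk; rewrite mulnC expgM expg_order expg1n perm1.
Qed.

Section Algebra.
Variable K : fieldType.
Local Notation KM := (monoid_alg K M).

Lemma not_central_const : ~ central_alg KM.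
Proof.
(* The index is one below the degree, so [elt r k u] has degree [N] and [lamM] makes it act
   trivially. *)
pose k := N.-1; have Nk : (N %| k.+1)%N by rewrite prednK ?lam_order_gt0.
move=> /(_ (mbase K (elt r k u))) [] => [|c].
  apply: in_center_mbase => m; rewrite -!mbaseM; congr mbase.
  have [-> | [n [x ->]]] := eltP ybe lnd idem m; first by rewrite mul1g mulg1.
  by rewrite !elt_mul // lamM_elt_order // lamM_elt_u addnC.
move/(congr1 (coef (elt r k u))); rewrite linearZ /= -mbase1 !coef_mbase eqxx.
by rewrite eq_sym elt_eq1 // mulr0 => /eqP; rewrite oner_eq0.
Qed.

Lemma noetherian_const : right_noetherian KM.
Proof.
(* The entry [1] serves the unit of [M]; every other element is [gen x * gen u ^+ n] by
   [elt_expg]. *)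
pose gs : seq KM := 1 :: [seq mbase K (gen x) | x <- enum X].
apply: (@right_noetherian_poly_span _ _ (mbase K (gen u)) gs) => a.
rewrite (coef_expand a); elim: (ssupp a) => [|m s IH].
  by rewrite big_nil; exact: poly_span0.
rewrite big_cons; apply: poly_spanZD IH.
have [-> | [n [x ->]]] := eltP ybe lnd idem m.
  by rewrite -[mbase K 1%g]mulr1 -(expr0 (mbase K (gen u)));
     apply: poly_span_genX; exact: mem_head.
rewrite elt_expg mbaseM mbaseX; apply: poly_span_genX.
by rewrite /gs in_cons; apply/orP; right; apply/mapP; exists x; rewrite ?mem_enum.
Qed.

Let d := #|X|.
Let scalar_emb : {rmorphism K -> 'M[{poly K}]_d} :=
  ((@scalar_mx {poly K} d) \o (@polyC K))%FUN.

(** The permutation matrix of [lamM m], weighted by a power of ['X] so that traces separate the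
    degrees. *)
Definition perm_rep (m : M) : 'M[{poly K}]_d :=
  \matrix_(i, j) ('X^(degM m) *+ (enum_val i == lamM m (enum_val j))).

Lemma perm_rep1 : perm_rep 1%g = 1.
Proof.
apply/matrixP => i j; rewrite !mxE degM_one // lamM_one // (inj_eq enum_val_inj).
by rewrite expr0.
Qed.

Lemma perm_repM m m' : perm_rep (m * m')%g = perm_rep m * perm_rep m'.
Proof.
apply/matrixP => i j; rewrite [RHS]mxE (bigD1 (enum_rank (lamM m' (enum_val j)))) //=.
rewrite big1 ?addr0 => [|k kj]; rewrite !mxE.
  rewrite enum_rankK eqxx degM_mul // lamM_mul //= exprD.
  by case: (_ == _); rewrite ?mulr1n // !mulr0n mul0r.
case: (enum_val k =P _) => [e|_]; last by rewrite mulr0n mulr0.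
by case/eqP: kj; rewrite -e enum_valK.
Qed.

Lemma scalar_embC k (A : 'M[{poly K}]_d) : scalar_emb k * A = A * scalar_emb k.
Proof. by rewrite [LHS]mul_scalar_mx [RHS]mul_mx_scalar. Qed.

Lemma mxtrace_scalar_emb k (A : 'M[{poly K}]_d) : \tr (scalar_emb k * A) = k%:P * \tr A.
Proof. by rewrite [scalar_emb k * A]mul_scalar_mx mxtraceZ. Qed.

(** The trace counts fixed points. In degree [k.+1], [lamM (elt r k u)] is the identity, and by
    [lamM_elt_inj] an [elt r k x] that agrees with it at a single point has [x = u]. *)
Lemma perm_rep_trace k m : (N %| k.+1)%N ->
  (\tr (perm_rep m))`_k.+1 = if m == elt r k u then #|X|%:R else 0.
Proof.
move=> Nk; rewrite coef_sum.
under eq_bigr => i _ do rewrite mxE coefMn coefXn.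
case: (m =P _) => [-> | m_neq].
  under eq_bigr => i _ do rewrite degM_elt // lamM_elt_order // !eqxx mulr1n.
  by rewrite sumr_const card_ord.
apply: big1 => i _; case: (k.+1 =P degM m) => [em|_]; last by rewrite mul0rn.
case: (enum_val i =P _) => // fix_i; case: m_neq.
have [e1 | [n [x ex]]] := eltP ybe lnd idem m; first by rewrite e1 degM_one in em.
move: em fix_i; rewrite ex degM_elt // => -[<-].
rewrite -{1}(lamM_elt_order Nk (enum_val i)) => /lamM_elt_inj <-.
by [].
Qed.

(** The image of [c] is nilpotent, so its trace is zero; the coefficient of that trace at ['X^k.+1]
    is the coefficient of [c] at [elt r k u] times [#|X|]. *)
Lemma coef_nilpotent k (c : KM) n : (#|X|%:R : K) != 0 -> (N %| k.+1)%N ->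
  c ^+ n = 0 -> coef (elt r k u) c = 0.
Proof.
move=> X_unit Nk cn; pose Psi := malg_lift scalar_emb perm_rep.
have [Psi1 PsiM] : monoid_morphism Psi.
  exact: (malg_lift_monoid scalar_embC perm_rep1 perm_repM).
have PsiX j : Psi (c ^+ j) = Psi c ^+ j.
  by elim: j => [|j IH]; rewrite ?Psi1 // !exprS PsiM IH.
have : \tr (Psi c) = 0.
  by apply: (@mxtrace_nilpotent _ _ _ n); rewrite -PsiX cn /Psi raddf0.
move/(congr1 (fun p : {poly K} => p`_k.+1)); rewrite coef0 /Psi /malg_lift.
have -> : \tr (\sum_(m <- ssupp c) scalar_emb (coef m c) * perm_rep m) =
    \sum_(m <- ssupp c) \tr (scalar_emb (coef m c) * perm_rep m) by exact: raddf_sum.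
rewrite coef_sum; under eq_bigr => m _ do rewrite mxtrace_scalar_emb coefCM perm_rep_trace //.
move=> tr0; apply/eqP; rewrite -(mulIr_eq0 _ (mulIf X_unit)); apply/eqP.
rewrite -[RHS]tr0 [in LHS](coef_expand c) linear_sum mulr_suml /=.
apply: eq_bigr => m _; rewrite linearZ /= coef_mbase -mulrA; congr (_ * _).
by case: eqP => _; rewrite ?mul1r ?mul0r.
Qed.

Lemma semiprime_const : (#|X|%:R : K) != 0 -> semiprime KM.
Proof.
move=> X_unit I [[_ _ IM] _] [n In] a Ia; apply: coef_ext => m.
have [m' [k [Nk mm']]] : exists m' k, (N %| k.+1)%N /\ (m * m')%g = elt r k u.
  have [-> | [j [x ->]]] := eltP ybe lnd idem m.
    exists (elt r N.-1 u), N.-1; rewrite mul1g; split=> //.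
    by rewrite prednK ?lam_order_gt0.
  (* The product has degree [j.+1 + l.+1 = N * j.+2], a multiple of [N], and the point of the right
     factor is chosen to be sent to [u]. *)
  pose l := (N * j.+2 - j.+2)%N; exists (elt r l (finv (lamM (elt r j x)) u)).
  exists (j + l).+1; rewrite elt_mul // f_finv //; split=> //.
  rewrite -addSn -addSn subnKC ?dvdn_mulr //; exact: leq_pmull lam_order_gt0.
rewrite linear0 -(coef_mulr_inj a m (@structure_mulr_inj m')) mm'.
apply: (@coef_nilpotent _ _ n X_unit Nk).
have := In (fun=> a * mbase K m') (fun=> IM _ _ Ia).
by rewrite prodr_const card_ord.
Qed.

End Algebra.
End ConstantDiag.

(** * Skew Laurent decomposition of a group algebra *)

Section IntPower.
Variables (G : groupType) (g : G).

Definition expgz (n : int) : G :=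
  match n with Posz k => (g ^+ k)%g | Negz k => (g ^- k.+1)%g end.

Lemma expgzS n : expgz (1 + n) = (g * expgz n)%g.
Proof.
case: n => [k | [|k]]; first by rewrite /= expgS.
  by rewrite /= expg1 mulgV.
have -> : 1 + Negz k.+1 = Negz k.
  by rewrite !NegzE -[k.+2]add1n PoszD opprD addrA subrr add0r.
by rewrite /= [in RHS]expgSr invgM mulgA mulgV mul1g.
Qed.

Lemma expgzP n : expgz (- 1 + n) = (g^-1 * expgz n)%g.
Proof.
by apply: (mulgI g); rewrite -expgzS addrA subrr add0r mulgA mulgV mul1g.
Qed.

Lemma expgzD m n : expgz (m + n) = (expgz m * expgz n)%g.
Proof.
elim/int_rec: m => [|k IH|k IH]; first by rewrite add0r mul1g.
  by rewrite intS -addrA !expgzS IH mulgA.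
by rewrite intS opprD -addrA !expgzP IH mulgA.
Qed.

Lemma expgzN n : expgz (- n) = ((expgz n)^-1)%g.
Proof. by apply: (mulgI (expgz n)); rewrite -expgzD subrr mulgV. Qed.

End IntPower.

Section MonoidAlgMaps.
Context (K : comNzRingType) (G : monoidType).

Lemma monoid_alg_linear_ext (B : lmodType K) (F F' : {linear monoid_alg K G -> B}) :
  (forall x, F (mbase K x) = F' (mbase K x)) -> F =1 F'.
Proof.
move=> FF' a; rewrite (coef_expand a) !linear_sum /=; apply: eq_bigr => x _.
by rewrite !linearZ /= FF'.
Qed.

Lemma monoid_alg_map_inj (H : monoidType) (f : G -> H) : injective f ->
    f 1%g = 1%g -> {morph f : x y / (x * y)%g} ->
  exists F : {lrmorphism monoid_alg K G -> monoid_alg K H},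
    injective F /\ forall x, F (mbase K x) = mbase K (f x).
Proof.
move=> f_inj f1 fM.
have [|x y|F [Fb FE]] := @malg_lift_alg K G (monoid_alg K H) (mbase K \o f).
- by rewrite /= f1 mbase1.
- by rewrite /= fM mbaseM.
exists F; split=> // a b ab; apply: coef_ext => x.
suff coefF c : coef (f x) (F c) = coef x c by rewrite -!coefF ab.
rewrite FE [in RHS](coef_expand c) !linear_sum /=; apply: eq_bigr => y _.
by rewrite !linearZ /= !coef_mbase (inj_eq f_inj).
Qed.

End MonoidAlgMaps.

(** * A group with finite torsion subgroup and infinite cyclic quotient *)

Section SkewLaurentIso.
Context (K : comNzRingType) (G : groupType) (T : finGroupType).
Variables (j : T -> G) (g : G).
Hypotheses (tors : torsion_subgroup j) (gen_g : coset_generates j g).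
Hypothesis nontors : exists h : G, forall n, (0 < n)%N -> (h ^+ n)%g <> 1%g.

Let jM x y : j (x * y)%g = (j x * j y)%g. Proof. by case: tors. Qed.
Let j_inj : injective j. Proof. by case: tors. Qed.
Let j1 : j 1%g = 1%g.
Proof. by apply: (mulgI (j 1%g)); rewrite -jM !mulg1. Qed.
Let jV x : j x^-1%g = (j x)^-1%g.
Proof. by apply: (mulgI (j x)); rewrite -jM !mulgV j1. Qed.
Let j_tors x : exists2 n, (0 < n)%N & ((j x) ^+ n)%g = 1%g.
Proof. by case: tors => _ _ tP; apply/tP; exists x. Qed.
Let torsE h n : (0 < n)%N -> (h ^+ n)%g = 1%g -> exists x, h = j x.
Proof. by case: tors => _ _ tP n0 hn; apply/tP; exists n. Qed.

(** Conjugation preserves finite order, so the image of [j] is normal. *)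
Let conj_tors (h : G) x : exists y, j y = (h * j x * h^-1)%g.
Proof.
have [n n0 xn] := j_tors x.
have conjX m : ((h * j x * h^-1) ^+ m = h * j x ^+ m * h^-1)%g.
  elim: m => [|m IH]; first by rewrite !expg0 mulg1 mulgV.
  by rewrite !expgS IH !mulgA mulgKV.
have [|y ->] := torsE n0 (h := (h * j x * h^-1)%g); last by exists y.
by rewrite conjX xn mulg1 mulgV.
Qed.

(** If a nonzero power of [g] were torsion, so would be [g], and then every element of [G], contrary
    to [nontors]. *)
Let g_nontors n x : expgz g n = j x -> n = 0.
Proof.
suff pos (k : nat) y : (g ^+ k.+1)%g <> j y.
  case: n => [[|k] | k] //= e; first by case: (pos k x).
  by case: (pos k x^-1%g); rewrite jV -e invgK.
move=> gk; have [m m0 ym] := j_tors y.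
have gkm : (g ^+ (k.+1 * m) = 1)%g by rewrite expgM gk.
have [|z ez] := torsE _ gkm; first by rewrite muln_gt0.
have [h hn] := nontors; have jX a l : j (a ^+ l)%g = (j a ^+ l)%g.
  by elim: l => [|l IH]; rewrite ?j1 // !expgS jM IH.
have [l [a ha]] := gen_g h; have [b hb] : exists b, h = j b.
  case: ha => ->; rewrite ez -jX -?jV -jM; by eexists.
by have [l' l'0 bl] := j_tors b; apply: (hn l') => //; rewrite hb.
Qed.

Let decomp h : exists p : T * int, h = (j p.1 * expgz g p.2)%g.
Proof.
have [n [x ex]] := gen_g h.
have aux m : h = (expgz g m * j x)%g -> exists p : T * int, h = (j p.1 * expgz g p.2)%g.
  have [y jy] := conj_tors (expgz g m) x.
  by move=> ->; exists (y, m); rewrite /= jy mulgKV.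
case: ex => e; [exact: (aux n%:Z) | apply: (aux (- n%:Z))].
by rewrite expgzN.
Qed.

Let decomp_uniq x y m n :
  (j x * expgz g m = j y * expgz g n)%g -> x = y /\ m = n.
Proof.
move=> e; have emn : m - n = 0.
  apply: (@g_nontors _ (x^-1 * y)%g); rewrite jM jV expgzD expgzN.
  by apply: (mulgI (j x)); rewrite !mulgA e mulgK mulgV mul1g.
move/eqP: emn; rewrite subr_eq0 => /eqP emn; split=> //.
by move: e; rewrite emn => /mulIg/j_inj.
Qed.

Lemma conj_alg_aut : exists sigma : alg_aut (monoid_alg K T),
  induced_by_conj j g sigma.
Proof.
have [psi psiP] := choice (conj_tors g).
have [psi' psi'P] := choice (conj_tors g^-1%g).
have lift_conj h (f : T -> T) : (forall x, j (f x) = h * j x * h^-1)%g ->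
  exists F : {lrmorphism monoid_alg K T -> monoid_alg K T},
    forall x, F (mbase K x) = mbase K (f x).
  move=> fP; have [|||F [_ FE]] := @monoid_alg_map_inj K T T f; last by exists F.
  - by move=> x y /(congr1 j); rewrite !fP => /mulIg/mulgI/j_inj.
  - by apply: j_inj; rewrite fP j1 mulg1 mulgV.
  - by move=> x y; apply: j_inj; rewrite fP !jM !fP !mulgA mulgKV.
have [F FE] := lift_conj _ _ psiP; have [F' F'E] := lift_conj _ _ psi'P.
have FK : cancel F F'.
  move=> a; apply: (@monoid_alg_linear_ext K T _ (F' \o F)%FUN idfun) => x.
  rewrite /= FE F'E; congr mbase; apply: j_inj; rewrite psi'P psiP invgK.
  by rewrite !mulgA mulVg mul1g mulgKV.
have F'K : cancel F' F.
  move=> a; apply: (@monoid_alg_linear_ext K T _ (F \o F')%FUN idfun) => x.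
  rewrite /= F'E FE; congr mbase; apply: j_inj; rewrite psiP psi'P invgK.
  by rewrite !mulgA mulgV mul1g mulgK.
exists (AlgAut FK F'K) => x; exists (psi x); [exact: psiP | exact: FE].
Qed.

(** Each element of [G] is uniquely [j x * expgz g n] and is sent to [x] times the [n]-th power of
    the variable. Moving [expgz g n] past [j y] conjugates [y], which is the twisted product. *)
Lemma skew_laurent_iso (sigma : alg_aut (monoid_alg K T)) :
    induced_by_conj j g sigma ->
  exists h : {lrmorphism monoid_alg K G -> skew_laurent sigma}, bijective h.
Proof.
move=> sigmaP; have [dec decP] := choice decomp.
pose cmp h := (dec h).1; pose dg h : int := (dec h).2.
have dec_uniq h x n : h = (j x * expgz g n)%g -> cmp h = x /\ dg h = n.
  by move=> e; apply: decomp_uniq; rewrite -decP.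
(* Iterates of [sigma], also negative ones, act on [T] as conjugation by the corresponding power of
   [g]. *)
have iterP n x : exists2 y, j y = (expgz g n * j x * (expgz g n)^-1)%g &
    aut_iter sigma n (mbase K x) = mbase K y.
  elim/int_rec: n => [|n [y jy ey]|n [y jy ey]].
  - by exists x => //; rewrite /= mul1g invg1 mulg1.
  - have [z jz ez] := sigmaP y; exists z; last by rewrite intS aut_iterS ey.
    by rewrite jz jy intS expgzS invgM !mulgA.
  have [z jz] := conj_tors g^-1%g y; exists z.
    by rewrite jz jy intS opprD expgzP invgM !mulgA.
  rewrite intS opprD aut_iterP ey; have [y' jy' ey'] := sigmaP z.
  suff -> : y = y' by rewrite -ey' aut_funK.
  by apply: j_inj; rewrite jy' jz invgK !mulgA mulgV mul1g mulgK.
pose f h : skew_laurent sigma :=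
  sbase (Defs.aut_action sigma) (dg h) (mbase K (cmp h)).
have [|h h'|F [Fb FE]] := @malg_lift_alg K G (skew_laurent sigma) f.
- have [|c d] := dec_uniq 1%g 1%g 0; first by rewrite j1 mulg1.
  by rewrite /f c d.
- have [y jy ey] := iterP (dg h) (cmp h').
  have [|c d] := dec_uniq (h * h')%g (cmp h * y)%g (dg h + dg h').
    rewrite {1}(decP h) {1}(decP h') jM jy expgzD -/(dg h) -/(dg h') -/(cmp h) -/(cmp h').
    by rewrite !mulgA mulgKV.
  rewrite /f sbase_mul c d [Defs.aut_action _ _ _]ey -mbaseM.
  by [].
(* The map only relabels coefficients; injectivity follows at once, and the preimage used for
   surjectivity is found by undoing the relabelling. *)
have coefF a x n : coef x (scoef n (F a)) = coef (j x * expgz g n)%g a.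
  rewrite FE [in RHS](coef_expand a) !linear_sum /=; apply: eq_bigr => h _.
  rewrite !linearZ /= coef_mbase scoef_base; congr (_ * _).
  case: (h =P _) => [/dec_uniq[-> ->] | ne].
    by rewrite eqxx coef_mbase eqxx.
  case: eqP => [dn|_]; last exact: linear0.
  rewrite coef_mbase; case: eqP => // cx; case: ne.
  by rewrite (decP h) -cx -dn.
exists F.
have F_inj : injective F.
  move=> a b ab; apply: coef_ext => h.
  by rewrite (decP h) -!coefF ab.
have F_surj b : exists a, F a = b.
  exists (\sum_(n <- ssupp b) \sum_(x <- ssupp (scoef n b))
    coef x (scoef n b) *: mbase K (j x * expgz g n)%g).
  rewrite [RHS](skew_expand b) linear_sum; apply: eq_bigr => n _.
  rewrite [in RHS](coef_expand (scoef n b)) !linear_sum; apply: eq_bigr => x _.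
  rewrite !linearZ /= Fb; congr (_ *: _).
  by have [|c d] := dec_uniq (j x * expgz g n)%g x n; rewrite // /f c d.
have [F' F'K] := choice F_surj.
by exists F' => // a; apply: F_inj; rewrite F'K.
Qed.

End SkewLaurentIso.

(** * The group of quotients *)

Section FinGroupOp.
Variables (X : finType) (op : X -> X -> X) (e : X) (inv : X -> X).
Hypotheses (opA : associative op) (op1 : left_id e op)
  (opV : left_inverse e inv op).

Definition op_carrier : Type := X.
HB.instance Definition _ := Finite.on op_carrier.
Definition op_group : finGroupType :=
  HB.pack op_carrier (Finite_isGroup.Build op_carrier opA op1 opV).

End FinGroupOp.

(* A synonym, because [H * Z] already carries the direct product structure. *)
Definition semidirect_carrier (H Z : Type) : Type := (H * Z)%type.
HB.instance Definition _ (H Z : choiceType) :=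
  Choice.copy (semidirect_carrier H Z) (H * Z)%type.

Section Semidirect.
Variables (H Z : groupType) (alpha : Z -> H -> H).
Hypotheses (alpha1 : forall x, alpha 1%g x = x)
  (alphaM : forall m n x, alpha (m * n)%g x = alpha m (alpha n x))
  (alphaD : forall n, {morph alpha n : x y / (x * y)%g}).
Local Notation C := (semidirect_carrier H Z).

Let alpha_one n : alpha n 1%g = 1%g.
Proof. by apply: (mulgI (alpha n 1%g)); rewrite -alphaD !mulg1. Qed.

Definition sd_one : C := (1%g, 1%g).
Definition sd_mul (a b : C) : C := (a.1 * alpha a.2 b.1, a.2 * b.2)%g.
Definition sd_inv (a : C) : C := (alpha a.2^-1%g a.1^-1%g, a.2^-1%g).

Lemma sd_mulA : associative sd_mul.
Proof.
by move=> a b c; rewrite /sd_mul /= alphaM alphaD !mulgA.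
Qed.
Lemma sd_mul1 : left_id sd_one sd_mul.
Proof. by move=> [x m]; rewrite /sd_mul /= alpha1 !mul1g. Qed.
Lemma sd_mulr1 : right_id sd_one sd_mul.
Proof. by move=> [x m]; rewrite /sd_mul /= alpha_one !mulg1. Qed.
Lemma sd_mulV : left_inverse sd_one sd_inv sd_mul.
Proof. by move=> [x m]; rewrite /sd_mul /= -alphaD !mulVg alpha_one. Qed.
Lemma sd_mulrV : right_inverse sd_one sd_inv sd_mul.
Proof. by move=> [x m]; rewrite /sd_mul /= -alphaM !mulgV alpha1 mulgV. Qed.

Definition semidirect : groupType :=
  HB.pack C (isGroup.Build C sd_mulA sd_mul1 sd_mulr1 sd_mulV sd_mulrV).

End Semidirect.

Section QuotientGroup.
Variables (X : finType) (r : X * X -> X * X).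
Local Notation M := (structure_monoid r).
Local Notation gen := (mgen r).
Hypotheses (ybe : yang_baxter r) (lnd : left_nondegenerate r)
  (idem : idempotent_map r).
Variable u : X.
Hypothesis diag_u : forall x, diag r x = u.

Let lamX_inj x : injective (lam r x) := bij_inj (lnd x).

Definition dot_group : finGroupType := op_group
  (dotA ybe lnd idem diag_u) (dot1x lnd u) (dotVx ybe lnd idem diag_u).
Local Notation T := dot_group.

Lemma Ssub_all (m : M) : m <> 1%g <-> Ssub r u m.
Proof.
split=> [m1 | [] //].
have [//|[n [x ->]]] := eltP ybe lnd idem m.
by apply/(SsubE ybe lnd idem); rewrite iterS diag_u.
Qed.

Lemma Ssub_elt n x : Ssub r u (elt r n x).
Proof. by apply/Ssub_all; exact: elt_neq1. Qed.

(** The group is the semidirect product of [T] with the integers acting through powers of [lam r u],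
    and [elt r n x] goes to the pair of [x] and its degree. *)
Lemma group_of_quotients_exists :
  exists (G : groupType) (i : M -> G), group_of_quotients (Ssub r u) i.
Proof.
have lam_inj : @injective T T (lam r u) by exact: lamX_inj.
pose p : {perm T} := perm lam_inj.
have pE (x : T) : p x = lam r u x by rewrite permE.
pose Z := Algebra.to_multiplicative int.
pose alpha (n : Z) (x : T) : T := expgz p n x.
have alpha1 x : alpha 1%g x = x by rewrite /alpha perm1.
have alphaM (m n : Z) x : alpha (m * n)%g x = alpha m (alpha n x).
  (* Permutations compose from left to right, so the exponents are swapped first. *)
  rewrite /alpha [(m * n)%g](addrC m n) [expgz p _]expgzD permM.
  by [].
have pM : {morph p : x y / (x * y)%g}.
  by move=> x y; rewrite !pE; exact: (dot_morph ybe lnd idem diag_u).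
have pVM : {morph p^-1%g : x y / (x * y)%g}.
  by move=> x y; apply: (@perm_inj _ p); rewrite pM !permKV.
have pXM (q : {perm T}) k : {morph q : x y / (x * y)%g} ->
    {morph (q ^+ k)%g : x y / (x * y)%g}.
  move=> qM; elim: k => [|k IH] x y; first by rewrite !perm1.
  by rewrite expgS !permM qM IH.
have alphaD n : {morph alpha n : x y / (x * y)%g}.
  case: n => k x y; rewrite /alpha /=; first exact: pXM.
  by rewrite -expgVn; exact: pXM.
pose G := semidirect alpha1 alphaM alphaD.
pose i (m : M) : G := (lamM m u : T, Posz (degM m)).
have alphaE k x : alpha (Posz k) x = iter k (lam r u) x.
  rewrite /alpha /= permX; elim: k => //= k ->; exact: pE.
have iM s t : i (s * t)%g = (i s * i t)%g.
  have -> : (i s * i t)%g = (((lamM s u : T) * alpha (Posz (degM s)) (lamM t u))%g,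
    (Posz (degM s) + Posz (degM t))%R) :> semidirect_carrier T Z by [].
  rewrite /i degM_mul // PoszD lamM_mul //=; congr (_, _).
  rewrite alphaE; have [-> | [n [x ->]]] := eltP ybe lnd idem s.
    rewrite degM_one // !lamM_one //; exact: (esym (mul1g (lamM t u : T))).
  by rewrite degM_elt // (lamM_elt_u ybe lnd diag_u) (lamM_elt ybe lnd diag_u).
have i_elt n x : i (elt r n x) = (x : T, Posz n.+1).
  by rewrite /i (lamM_elt_u ybe lnd diag_u) degM_elt.
exists G, i; split=> [s t _ _ | s t | [x n]]; first exact: iM.
  move=> /Ssub_all s1 /Ssub_all t1.
  have [//|[n [x ->]]] := eltP ybe lnd idem s.
  have [//|[k [y ->]]] := eltP ybe lnd idem t.
  by rewrite !i_elt => -[-> ->].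
(* The denominator [elt r k u] is taken of degree large enough to make the numerator's degree
   positive. *)
have [k [l el]] : exists k l : nat, n + Posz k.+1 = Posz l.+1.
  case: (n) => a; first by exists 0%N, a; rewrite -PoszD addn1.
  by exists a.+1, 0%N; rewrite NegzE -[a.+2]addn1 PoszD addrA addNr.
exists (elt r l x), (elt r k u); split; [exact: Ssub_elt.. |].
apply: (mulIg (i (elt r k u))); rewrite mulgVK !i_elt.
have -> : (((x, n) : G) * ((u : T, Posz k.+1) : G))%g =
  (((x : T) * alpha n (1 : T))%g, n + Posz k.+1) :> semidirect_carrier T Z by [].
rewrite el; congr (_, _).
have -> : alpha n 1%g = 1%g.
  by apply: (mulgI (alpha n 1%g)); rewrite -alphaD !mulg1.
exact: mulg1.
Qed.

Section Quotients.
Variables (G : groupType) (i : M -> G).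
Hypothesis quot : group_of_quotients (Ssub r u) i.
Let tau : G := i (gen u).

Let iM n x k y : i (elt r n x * elt r k y)%g = (i (elt r n x) * i (elt r k y))%g.
Proof. by case: quot => iM _ _; apply: iM; exact: Ssub_elt. Qed.

Let i_inj n x k y : i (elt r n x) = i (elt r k y) -> n = k /\ x = y.
Proof.
case: quot => _ inj _ e; apply: (elt_inj ybe lnd idem).
by apply: inj e; exact: Ssub_elt.
Qed.

(** Chosen so that [i (elt r n x)] becomes [j x * tau ^+ n.+1]; [locked] keeps the product folded
    during rewriting. *)
Definition quot_incl (x : T) : G := locked (i (gen x) * tau^-1)%g.
Local Notation j := quot_incl.

Let i_gen x : i (gen x) = (j x * tau)%g.
Proof. by rewrite /j -lock mulgKV. Qed.

Let i_elt n x : i (elt r n x) = (j x * tau ^+ n.+1)%g.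
Proof.
elim: n => [|n IH]; first by rewrite expg1 -i_gen.
by rewrite (eltS ybe lnd diag_u) -[gen u]/(elt r 0 u) iM IH -mulgA -expgSr.
Qed.

Let tau_j (x : T) : (tau * j x = j (lam r u x) * tau)%g.
Proof.
apply: (mulIg tau); rewrite -!mulgA -!i_gen -[tau in LHS]/(i (elt r 0 u)).
rewrite -[gen x]/(elt r 0 x) -iM elt_mul // i_elt expgS expg1.
by rewrite lamM_mgen.
Qed.

(** Multiplied by [tau ^+ 2], with [y = lam r u y'], both sides become the image of
    [gen x * gen y']; [tau] passes [j y'] by [tau_j]. *)
Let jM (x y : T) : j (x * y)%g = (j x * j y)%g.
Proof.
pose y' := finv (lam r u) y; have ey : y = lam r u y' by rewrite f_finv.
apply: (mulIg (tau ^+ 2)%g); rewrite expgS expg1.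
have -> : (j x * j y * (tau * tau) = j x * tau * (j y' * tau))%g.
  by rewrite ey -!mulgA; congr (_ * _)%g; rewrite !mulgA tau_j.
rewrite -!i_gen -[gen x]/(elt r 0 x) -[gen y']/(elt r 0 y') -iM elt_mul //.
by rewrite i_elt lamM_mgen // -(dot_lam lnd) -ey.
Qed.

Let j1 : j 1%g = 1%g.
Proof. by apply: (mulgI (j 1%g)); rewrite -jM !mulg1. Qed.
Let jV x : j x^-1%g = (j x)^-1%g.
Proof. by apply: (mulgI (j x)); rewrite -jM !mulgV j1. Qed.
Let jX x n : j (x ^+ n)%g = (j x ^+ n)%g.
Proof. by elim: n => [|n IH]; rewrite ?j1 // !expgS jM IH. Qed.

Let j_inj : injective j.
Proof.
move=> x y; rewrite /j -!lock => /mulIg.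
by rewrite -[gen x]/(elt r 0 x) -[gen y]/(elt r 0 y) => /i_inj[].
Qed.

Let tauX_j d x : exists y, (tau ^+ d * j x = j y * tau ^+ d)%g.
Proof.
elim: d x => [|d IH] x; first by exists x; rewrite mul1g mulg1.
have [y ey] := IH (lam r u x); exists y.
by rewrite expgSr -mulgA tau_j mulgA ey -mulgA.
Qed.

Let j_tauX d x : exists y, (j x * tau ^+ d = tau ^+ d * j y)%g.
Proof.
elim: d x => [|d IH] x; first by exists x; rewrite mul1g mulg1.
have [y ey] := IH (finv (lam r u) x); exists y.
rewrite expgS -(mulgA tau) -ey !mulgA tau_j; congr (j _ * _ * _)%g.
by rewrite f_finv.
Qed.

(** One more factor [tau] makes both exponents positive, where [i_elt] and [i_inj] apply. *)
Let tau_free n x k y : (j x * tau ^+ n = j y * tau ^+ k)%g -> n = k /\ x = y.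
Proof.
move=> e; apply: i_inj; rewrite !i_elt !expgSr !mulgA.
by rewrite e.
Qed.

(* Up to inversion, every element of [G] is [j x * tau ^+ d * (j y)^-1]. *)
Let decompose (P : G -> Prop) :
  (forall h, P h -> P h^-1%g) ->
  (forall x d y, P (j x * tau ^+ d * (j y)^-1)%g) -> forall h, P h.
Proof.
move=> PV Pd h; have [_ _ /(_ h)[s [t [/Ssub_all s1 /Ssub_all t1 ->]]]] := quot.
have aux a x b y : (a <= b)%N -> P (i (elt r b x) * (i (elt r a y))^-1)%g.
  move=> ab; rewrite !i_elt invgM mulgA -(subnK ab) -addnS expgD mulgA mulgK.
  exact: Pd.
have [//|[n [x ->]]] := eltP ybe lnd idem s.
have [//|[k [y ->]]] := eltP ybe lnd idem t.
have [kn | /ltnW nk] := leqP k n; first exact: aux.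
have -> : (i (elt r n x) * (i (elt r k y))^-1 =
  (i (elt r k y) * (i (elt r n x))^-1)^-1)%g by rewrite invgM invgK.
by apply: PV; exact: aux.
Qed.

(** Up to inversion an element is [j w * tau ^+ d], whose [n]-th power has [tau]-exponent [d * n];
    finite order forces [d = 0]. Conversely [T] is finite. *)
Lemma quot_torsion : torsion_subgroup j.
Proof.
split=> // g; split=> [[n n0 gn] | [x ->]]; last first.
  by exists #[x]%g; rewrite ?order_gt0 // -jX expg_order j1.
move: g gn; apply: (decompose (P := fun g => (g ^+ n = 1)%g -> exists x, g = j x)).
  move=> h Ph; rewrite expgVn => /eqP; rewrite invg_eq1 => /eqP/Ph[x hx].
  by exists (x^-1)%g; rewrite jV -hx.
move=> x d y; have [z ez] := tauX_j d (y^-1)%g.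
rewrite -jV -mulgA ez mulgA -jM; set w := (x * z)%g => wn.
have [v ev] : exists v, ((j w * tau ^+ d) ^+ n = j v * tau ^+ (d * n))%g.
  elim: (n) => [|m [v ev]]; first by exists 1%g; rewrite muln0 j1 mulg1.
  have [v' ev'] := tauX_j d v; exists (w * v')%g.
  by rewrite expgS ev jM mulnS expgD !mulgA -(mulgA (j w)) ev' !mulgA.
have [/eqP] : (d * n)%N = 0%N /\ v = 1%g.
  by apply: tau_free; rewrite -ev wn j1 mulg1.
by rewrite muln_eq0 (gtn_eqF n0) orbF => /eqP -> _; exists w; rewrite mulg1.
Qed.

Lemma quot_nontorsion n : (0 < n)%N -> (tau ^+ n)%g <> 1%g.
Proof.
move=> n0 tn; have [e _] : n = 0%N /\ (1%g : T) = 1%g.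
  by apply: tau_free; rewrite tn mulg1.
by rewrite e in n0.
Qed.

(** In a quotient the powers of [tau] combine, the sign of the degree difference selects the
    disjunct, and the factor from [j] is moved to the right. *)
Lemma quot_coset_generates : coset_generates j tau.
Proof.
move=> h; have [_ _ /(_ h)[s [t [/Ssub_all s1 /Ssub_all t1 ->]]]] := quot.
have [//|[n [x ->]]] := eltP ybe lnd idem s.
have [//|[k [y ->]]] := eltP ybe lnd idem t.
rewrite !i_elt invgM -jV mulgA; have [kn | /ltnW nk] := leqP k n.
  rewrite -(subnK kn) -addnS expgD mulgA mulgK.
  have [z ez] := j_tauX (n - k) x; exists (n - k)%N, (z * (y : T)^-1)%g; left.
  by rewrite ez -mulgA -jM.
rewrite -(subnK nk) -addnS expgD invgM mulgA mulgK; set d := (k - n)%N.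
have [z ez] := tauX_j d x; exists d, (z * (y : T)^-1)%g; right.
rewrite jM mulgA; congr (_ * _)%g.
by apply: (mulgI (tau ^+ d)%g); rewrite !mulgA ez mulgK mulgV mul1g.
Qed.

End Quotients.
End QuotientGroup.

(** The map [lam r e] is [phi], so [phi] sends [u] to the unit [e]; then [lam r x u = x] for every
    [x]. *)
Lemma diag_const_op (X : finType) (r : X * X -> X * X)
    (op : X -> X -> X) (phi : X -> X) : left_nondegenerate r -> is_group op ->
    (forall x y, lam r x y = op x (phi y)) ->
  forall y y', diag r y = diag r y'.
Proof.
move=> lnd [_ [e [inv [e1 e2 _ _]]]] lamE y y'.
have lam_inj x : injective (lam r x) := bij_inj (lnd x).
pose u := finv (lam r e) e.
have phi_u : phi u = e by rewrite -[LHS]e1 -lamE f_finv.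
suff du x : diag r x = u by rewrite !du.
by apply: (lam_inj x); rewrite lam_diag // lamE phi_u e2.
Qed.

(** * Embedding of the structure algebra, and the equivalences *)

Section Final.
Variables (X : finType) (r : X * X -> X * X) (K : fieldType).
Local Notation M := (structure_monoid r).
Hypotheses (ybe : yang_baxter r) (lnd : left_nondegenerate r)
  (idem : idempotent_map r).
Variable u : X.
Hypothesis diag_u : forall x, diag r x = u.

Lemma embedding_in_quotient_algebra (G : groupType) (i : M -> G) :
    group_of_quotients (Ssub r u) i ->
  exists f : {lrmorphism monoid_alg K M -> monoid_alg K G},
    injective f /\ forall m, Ssub r u m -> f (mbase K m) = mbase K (i m).
Proof.
(* The map [i] is controlled on [Ssub r u] only, so its value at the unit is reset to [1]. *)
case=> iM i_inj _; pose i' (m : M) : G := if m == 1%g then 1%g else i m.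
have S_all m : m <> 1%g -> Ssub r u m by move/(Ssub_all ybe lnd idem diag_u).
have prod_neq1 m m' : m <> 1%g -> (m * m')%g <> 1%g :> M.
  move=> m1 /(congr1 (@degM X r)); rewrite degM_mul // degM_one //.
  by have [//|[n [x ->]]] := eltP ybe lnd idem m; rewrite degM_elt.
(* If [i m] were [1], then [m * m] and [m] would have the same image, so [m] would be idempotent,
   hence [1] by cancellation. *)
have i_neq1 m : m <> 1%g -> i m <> 1%g.
  move=> m1 im; apply: (m1).
  have mm : (m * m)%g = m.
    apply: i_inj; [by apply: S_all; apply: prod_neq1 | exact: S_all|].
    by rewrite iM ?im ?mulg1 //; exact: S_all.
  by apply: (structure_mull_inj ybe lnd idem (m := m)); rewrite mm mulg1.
have i'M : {morph i' : x y / (x * y)%g}.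
  move=> x y; rewrite /i'; case: (x =P 1%g) => [-> | x1]; first by rewrite !mul1g.
  case: (y =P 1%g) => [-> | y1]; first by rewrite !mulg1 ifN //; exact/eqP.
  by rewrite ifN; [apply: iM; exact: S_all | apply/eqP; exact: prod_neq1].
have i'_inj : injective i'.
  move=> x y; rewrite /i'; case: (x =P 1%g) => [-> | x1]; case: (y =P 1%g) => [-> | y1] //.
  - by move/esym/i_neq1.
  - by move/i_neq1.
  - by apply: i_inj; exact: S_all.
have [|F [F_inj FE]] := monoid_alg_map_inj K i'_inj _ i'M; first by rewrite /i' eqxx.
exists F; split=> // m [m1 _]; rewrite FE /i' ifN //; exact/eqP.
Qed.

End Final.

Theorem theorem3p12 (X : finType) (r : X * X -> X * X) (K : fieldType)
    (X_nonempty : (0 < #|X|)%N) (r_ybe : yang_baxter r)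
    (r_lnd : left_nondegenerate r) (r_idem : idempotent_map r) :
  let M := structure_monoid r in
  let KM := monoid_alg K M in
  let C1 := #|Lambda r| = 1%N in
  let C2 := cancellative M in
  let C3 := exists op : X -> X -> X, is_group op /\
              exists phi : X -> X, {morph phi : x y / op x y} /\
                forall x y, lam r x y = op x (phi y) in
  let C4 := right_noetherian KM in
  let C5 := ~ central_alg KM in
  let C6 := semiprime KM in
  [/\ [<-> C1; C2; C3; C4; C5],
      (forall p, p \in [pchar K] -> ~~ (p %| #|X|)%N) ->
        [<-> C1; C2; C3; C4; C5; C6],
      C6 -> C1
    & C1 \/ C2 \/ C3 \/ C4 \/ C5 \/ C6 ->
      exists2 u, Lambda r = [set u] &
        (exists (G : groupType) (i : M -> G),
           group_of_quotients (Ssub r u) i) /\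
        forall (G : groupType) (i : M -> G),
          group_of_quotients (Ssub r u) i ->
          (exists f : {lrmorphism KM -> monoid_alg K G},
             injective f /\
             forall m, Ssub r u m -> f (mbase K m) = mbase K (i m)) /\
          exists (T : finGroupType) (j : T -> G),
            [/\ torsion_subgroup j,
                exists g, coset_generates j g
              & forall g, coset_generates j g ->
                  exists sigma : alg_aut (monoid_alg K T),
                    induced_by_conj j g sigma /\
                    exists h : {lrmorphism monoid_alg K G ->
                                           skew_laurent sigma},
                      bijective h]].
Proof.
move=> M KM C1 C2 C3 C4 C5 C6.
have C1E : C1 <-> exists u, forall x, diag r x = u by exact: card_Lambda1P.
have C1_const : C1 <-> forall y y', diag r y = diag r y'.
  rewrite C1E; split=> [[u du] y y' | const]; first by rewrite !du.
  by have /card_gt0P[x0 _] := X_nonempty; exists (diag r x0) => x; exact: const.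
have C2_1 : C2 -> C1 by move=> c2; apply/C1_const; exact: diag_const_cancellative c2.
have C3_1 : C3 -> C1.
  move=> [op [opG [phi [_ lamE]]]]; apply/C1_const; exact: diag_const_op opG lamE.
have C4_1 : C4 -> C1.
  by move=> c4; apply/C1_const; apply: contrapT => nc; exact: not_noetherian_nonconst c4.
have C5_1 : C5 -> C1.
  by move=> c5; apply/C1_const; apply: contrapT => nc; apply: c5; exact: central_nonconst.
have C6_1 : C6 -> C1.
  by move=> c6; apply/C1_const; apply: contrapT => nc; exact: not_semiprime_nonconst c6.
have C1_2 : C1 -> C2 by move/C1E => [u du]; exact: structure_cancellative du.
have C1_3 : C1 -> C3.
  move/C1E => [u du]; exists (dotX r u); split; first exact: dot_is_group.
  by exists (lam r u); split=> [x y | x y]; [exact: dot_morph | rewrite dot_lam].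
have C1_4 : C1 -> C4.
  by move/C1E => [u du]; exact: (@noetherian_const X r r_ybe r_lnd r_idem u du K).
have C1_5 : C1 -> C5.
  by move/C1E => [u du]; exact: (@not_central_const X r r_ybe r_lnd r_idem u du K).
split=> //.
- by tfae=> // [/C2_1 | /C3_1 | /C4_1].
- move=> charX; have C1_6 : C1 -> C6.
    move/C1E => [u du]; apply: (@semiprime_const X r r_ybe r_lnd r_idem u du K).
    rewrite natf_neq0_pchar; apply/pnatP => // p p_pr pX.
    by apply/negP => /charX; rewrite pX.
  by tfae=> // [/C2_1 | /C3_1 | /C4_1 | /C5_1].
move=> Cs; have /C1E[u du] : C1.
  by case: Cs => [// | [/C2_1 // | [/C3_1 // | [/C4_1 // | [/C5_1 // | /C6_1]]]]].
exists u.
  apply/setP => y; apply/imsetP/set1P => [[x _ ->] // | ->].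
  by have /card_gt0P[x0 _] := X_nonempty; exists x0.
split=> [|G i quot]; first exact: (group_of_quotients_exists r_ybe r_lnd r_idem du).
split; first exact: (embedding_in_quotient_algebra K r_ybe r_lnd r_idem du quot).
have tors := quot_torsion r_ybe r_lnd r_idem du quot.
exists (dot_group r_ybe r_lnd r_idem du), (quot_incl (diag_u := du) i).
split=> //; first by exists (i (mgen r u)); exact: quot_coset_generates.
move=> g gen_g; have [sigma sigmaP] := conj_alg_aut K g tors.
exists sigma; split=> //; apply: (skew_laurent_iso tors gen_g) => //.
(* The image of [u] has infinite order, whatever generator [g] was chosen. *)
by exists (i (mgen r u)) => n; exact: (quot_nontorsion r_ybe r_lnd r_idem du quot).
Qed.
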